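(* The classification of outerplanar, connected graphs $G$ according to $A_2(G)$ is given by the following table (each row lists a value of $A_2(G)$, followed by the graphs $G$ attaining it): - $A_2(G)=\emptyset$: $K_1$; - $A_2(G)=\{0\}$: $K_2$; - $A_2(G)=\{1\}$: $D_\ell$, $\ell\geq 1$; - $A_2(G)=\{0,1\}$: $G$ contains no $4$-cycles, and $G\not\simeq D_\ell,K_1,K_2$; - $A_2(G)=\{0,2\}$: the square; - $A_2(G)=\{1,2\}$: $\mathcal{R}$; - $A_2(G)=\{0,1,2\}$: otherwise.
   Context: All graphs are simple and finite. A graph is outerplanar if it admits a planar embedding where one region contains all vertices. For distinct vertices $u_1,u_2$ of $G$, $N(u_1,u_2)$ is the set of vertices adjacent to both $u_1$ and $u_2$, and $A_2(G):=\{a : \exists \text{ distinct } u_1,u_2\in V(G) \text{ satisfying } |N(u_1,u_2)|=a\}$. $K_\ell$ denotes the complete graph on $\ell$ vertices, and the square is the cycle of length $4$. $D_\ell$, $\ell\geq 1$, is the graph formed by $\ell$ triangles with a common vertex. $P_\ell$ is the simple path on $\ell\geq 2$ vertices. $G_1+G_2$ denotes graph addition: $V(G_1+G_2)=V(G_1)\cup V(G_2)$ and $E(G_1+G_2)=E(G_1)\cup E(G_2)\cup\{u_1u_2 : u_1\in V(G_1),\ u_2\in V(G_2)\}$. Finally, $\mathcal{R}_\ell:=\{H+K_1 : H\text{ is a subgraph of }P_\ell\text{ with no isolated vertices}\}$ and $\mathcal{R}:=\bigcup_{\ell\geq 3}\mathcal{R}_\ell$.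
   Formalization: Row {1,2} is corrected to ''R without the D_ℓ, together with the 3-sun'' (triangle with a further triangle on each side), and ''otherwise'' changes accordingly: each D_ℓ lies in R but has A_2={1}, and the 3-sun is connected and outerplanar with A_2={1,2} but is not in R. *)

(* Defs.v *)
From HB Require Import structures.
From mathcomp Require Import all_boot all_order all_algebra.
From mathcomp Require Import all_classical all_reals all_analysis.

Set Implicit Arguments.
Unset Strict Implicit.
Unset Printing Implicit Defensive.

Import Order.TTheory GRing.Theory Num.Theory.
Import numFieldNormedType.Exports.

(** * Finite simple graphs *)

Record sgraph := SGraph {
  vertex :> finType;
  adj : rel vertex;
  adj_sym : symmetric adj;
  adj_irr : irreflexive adj
}.

Definition isomorphic (G H : sgraph) : Prop :=
  exists f : G -> H,
    bijective f /\ forall x y : G, adj (f x) (f y) = adj x y.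

(* Subgraphs are not required to be induced or spanning; the notion is up to
   isomorphism, so [subgraph H G] also reads "G contains a copy of H". *)
Definition subgraph (H G : sgraph) : Prop :=
  exists f : H -> G,
    injective f /\ forall x y : H, adj x y -> adj (f x) (f y).

(* The graph without vertices is not connected. *)
Definition connected_graph (G : sgraph) : Prop :=
  (0 < #|G|)%N /\ forall x y : G, connect (@adj G) x y.

Definition no_isolated_vertex (G : sgraph) : Prop :=
  forall x : G, exists y : G, adj x y.

Section CommonNeighbours.
Variable G : sgraph.

Definition common_nbrs (u1 u2 : G) : {set G} :=
  [set x | adj u1 x && adj u2 x]%SET.

Definition A2 : set nat :=
  [set a | exists u1 u2 : G, u1 <> u2 /\ #|common_nbrs u1 u2| = a]%classic.

End CommonNeighbours.

(** * Particular graphs *)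

Section Complete.
Variable l : nat.
Definition complete_adj : rel 'I_l := fun i j => i != j.
Fact complete_sym : symmetric complete_adj.
Proof. by move=> i j; rewrite /complete_adj eq_sym. Qed.
Fact complete_irr : irreflexive complete_adj.
Proof. by move=> i; rewrite /complete_adj eqxx. Qed.
Definition complete_graph := SGraph complete_sym complete_irr.
End Complete.

Section Path.
Variable l : nat.
Definition path_adj : rel 'I_l := fun i j => (i.+1 == j :> nat) || (j.+1 == i :> nat).
Fact path_sym : symmetric path_adj.
Proof. by move=> i j; rewrite /path_adj orbC. Qed.
Fact path_irr : irreflexive path_adj.
Proof. by move=> i; rewrite /path_adj orbb gtn_eqF. Qed.
Definition path_graph := SGraph path_sym path_irr.
End Path.

Definition square_adj : rel 'I_4 :=
  fun i j => (i.+1 %% 4 == j) || (j.+1 %% 4 == i).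
Fact square_sym : symmetric square_adj.
Proof. by move=> i j; rewrite /square_adj orbC. Qed.
Fact square_irr : irreflexive square_adj.
Proof. by case=> [[|[|[|[|]]]]]. Qed.
Definition square_graph := SGraph square_sym square_irr.

(* [None] is the vertex shared by the [l] triangles; the [i]-th triangle
   consists of [None], [Some (i, false)] and [Some (i, true)]. *)
Section Friendship.
Variable l : nat.
Definition friendship_adj : rel (option ('I_l * bool)) := fun x y =>
  match x, y with
  | None, None => false
  | None, Some _ | Some _, None => true
  | Some (i, b), Some (j, c) => (i == j) && (b != c)
  end.
Fact friendship_sym : symmetric friendship_adj.
Proof. by case=> [[i b]|] [[j c]|] //=; rewrite eq_sym [b == c]eq_sym. Qed.
Fact friendship_irr : irreflexive friendship_adj.
Proof. by case=> [[i b]|] //=; rewrite !eqxx. Qed.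
Definition friendship_graph := SGraph friendship_sym friendship_irr.
End Friendship.

(* The 3-sun: the [inl i] span a triangle, and [inr j] is adjacent exactly to
   the two [inl i] with [i != j].  It is a maximal outerplanar graph (a hexagon
   with its three short chords) in which any two vertices have one or two common
   neighbours, but no vertex is adjacent to all others. *)
Definition sun_adj : rel ('I_3 + 'I_3)%type := fun x y =>
  match x, y with
  | inl i, inl j | inl i, inr j | inr i, inl j => i != j
  | inr _, inr _ => false
  end.
Fact sun_sym : symmetric sun_adj.
Proof. by case=> i [] j //=; rewrite eq_sym. Qed.
Fact sun_irr : irreflexive sun_adj.
Proof. by case=> i //=; rewrite eqxx. Qed.
Definition sun_graph := SGraph sun_sym sun_irr.

Section Join.
Variables G1 G2 : sgraph.
Definition join_adj : rel (G1 + G2)%type := fun x y =>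
  match x, y with
  | inl a, inl b => adj a b
  | inr a, inr b => adj a b
  | _, _ => true
  end.
Fact join_sym : symmetric join_adj.
Proof. by case=> a [] b //=; rewrite adj_sym. Qed.
Fact join_irr : irreflexive join_adj.
Proof. by case=> a /=; rewrite adj_irr. Qed.
Definition join_graph := SGraph join_sym join_irr.
End Join.

(* [H] must have a vertex: the empty graph vacuously has no isolated vertices,
   and would yield [K_1].  Perfect matchings [H] are admitted, so every
   [friendship_graph l] with [l >= 1] belongs to the family. *)
Definition family_R_at (l : nat) (G : sgraph) : Prop :=
  exists H : sgraph,
    [/\ (0 < #|H|)%N, subgraph H (path_graph l), no_isolated_vertex H
      & isomorphic G (join_graph H (complete_graph 1))].

Definition family_R (G : sgraph) : Prop :=
  exists l : nat, (3 <= l)%N /\ family_R_at l G.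

Definition is_friendship (G : sgraph) : Prop :=
  exists l : nat, (1 <= l)%N /\ isomorphic G (friendship_graph l).

(** * Planar embeddings and outerplanarity *)

Local Open Scope classical_set_scope.
Local Open Scope ring_scope.

Section Planar.
Variable R : realType.
Local Notation plane := (R * R)%type.

Definition is_arc (C : set plane) (p q : plane) : Prop :=
  exists f : R -> plane,
    [/\ {within `[0, 1], continuous f}, {in `[0, 1] &, injective f},
        f 0 = p, f 1 = q & C = f @` `[0, 1]].

Variable G : sgraph.

(* The vertex [v] is drawn as the point [p v] and the edge [xy] as the arc
   [arc x y]; values of [arc] at non-adjacent pairs are irrelevant. *)
Definition planar_embedding (p : G -> plane) (arc : G -> G -> set plane) : Prop :=
  [/\ injective p,
      forall x y, adj x y -> arc x y = arc y x /\ is_arc (arc x y) (p x) (p y),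
      forall x y z, adj x y -> arc x y (p z) -> z = x \/ z = y
    & forall x y z w, adj x y -> adj z w -> [set x; y]%SET <> [set z; w]%SET ->
        arc x y `&` arc z w `<=` range p].

Definition drawing (p : G -> plane) (arc : G -> G -> set plane) : set plane :=
  range p `|` [set q | exists x y, adj x y /\ arc x y q].

(* The regions are the connected components of the complement of the drawing. *)
Definition is_region (p : G -> plane) (arc : G -> G -> set plane)
    (F : set plane) : Prop :=
  exists2 q, (~` drawing p arc) q & F = connected_component (~` drawing p arc) q.

(* A region is open and disjoint from the drawing: it "contains" a vertex when
   the vertex lies on its boundary. *)
Definition outerplanar : Prop :=
  exists p arc, planar_embedding p arc /\
    exists2 F, is_region p arc F & forall v, closure F (p v).

End Planar.

(* Main.v *)
Require Import Defs.
From mathcomp Require Import all_boot all_order all_algebra.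
From mathcomp Require Import all_classical all_reals all_analysis.
From mathcomp Require Import ring lra zify.

Set Implicit Arguments.
Unset Strict Implicit.
Unset Printing Implicit Defensive.

Import Order.TTheory GRing.Theory Num.Theory.
Import numFieldNormedType.Exports.

(** The proof has a topological half, which extracts from an outerplanar
    drawing two forbidden configurations and conversely draws the graphs of the
    table, and a combinatorial half, which works with the forbidden
    configurations only.

    _Forbidden configurations._  An outerplanar graph contains neither [K_4]
    ([no_K4]) nor a theta, that is two vertices joined by three internally
    disjoint paths of length at least two ([no_theta]).  A point of the region
    whose closure contains all vertices acts as an additional vertex: it can be
    joined to each vertex by a connected compact set avoiding all edges not
    incident to that vertex ([outer_hub]).  A theta would then give [K_{3,3}]
    and a [K_4] would give [K_5], drawn with connected compact sets as edges,
    independent edges being disjoint.  No form of the Jordan curve theorem is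
    needed to exclude this.  If two independent edges are disjoint, they have
    positive distance and can be replaced by chains of points with small steps;
    as one point runs along the first chain and another along the second, their
    difference vector never vanishes, so along the boundary of the square of
    parameters it crosses the positive horizontal axis an even number of times
    ([turns_quad]).  Summing over all pairs of independent edges of [K_{3,3}] or
    [K_5], every contribution of a vertex and an edge cancels, because it occurs
    in two squares, but a constant 1 remains: this is van Kampen's obstruction
    ([van_kampen_obstruction], [K33_nonplanar], [K5_nonplanar]).

    _Drawings._  A graph whose vertices can be numbered so that no two edges
    interleave is outerplanar: vertices are placed on the horizontal axis and
    edges are drawn below it as arcs of parabolas
    ([outerplanar_of_numbering]).

    _Combinatorics._  Without a theta, two vertices have at most two common
    neighbours, so [A_2(G)] is a subset of [{0, 1, 2}].  If any two vertices have
    exactly one common neighbour, then a vertex missing another one lies in a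
    single triangle, since otherwise there is a theta; hence some vertex is
    adjacent to all others ([friendship_universal]) and the triangles through
    it make up the whole graph.  If the numbers of common neighbours are 0 or 2
    and 2 occurs, then no vertex has degree three and the graph is a 4-cycle
    ([zero_two_square]); in particular [A_2(G) = {2}] does not happen.  If any two
    vertices have a common neighbour and some pair has two, then either some
    vertex is adjacent to all others, and deleting it leaves a graph of maximum
    degree two without cycles, i.e. a union of paths ([universal_family_R]), or
    the graph is the 3-sun ([no_universal_sun]). *)

(** * Crossing parities of polygonal chains *)
Section Parity.
Local Open Scope ring_scope.
Variable R : realFieldType.
Implicit Types (z w a b c e : R * R) (d : R).

(** The vectors above the horizontal axis, the axis itself being cut at the
    origin and its positive half included.  Thus exactly one of [z] and [- z] is
    upper when [z] is nonzero, and [upper (z - w)] compares [z] and [w] in a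
    lexicographic order. *)
Definition upper z := (0 < z.2) || ((z.2 == 0) && (0 < z.1)).
(** The short step from [z] to [w] crosses the positive horizontal axis.  The
    abscissa of [z] alone is tested: a step that changes half-plane far from the
    origin stays on one side of the vertical axis. *)
Definition cuts z w := (upper z (+) upper w) && (0 < z.1).
(** Distances are taken in the maximum norm: [far d z] says that [z] has norm at
    least [d], and [nearby d z w] that [z] and [w] are at distance less than [d]. *)
Definition far d z := (d <= `|z.1|) || (d <= `|z.2|).
Definition nearby d z w := (`|z.1 - w.1| < d) && (`|z.2 - w.2| < d).

Lemma upperB z w : z != w -> upper (w - z) = ~~ upper (z - w).
Proof.
case: z w => [x y] [x' y']; rewrite /upper /= xpair_eqE => ne.
have [h|h|h] := ltgtP y y'.
- have -> : 0 < y' - y by lra.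
  have -> : (0 < y - y') = false by lra.
  by have -> : (y - y' == 0) = false by lra.
- have -> : (0 < y' - y) = false by lra.
  have -> : 0 < y - y' by lra.
  by have -> : (y' - y == 0) = false by lra.
have {ne} : x != x' by rewrite h eqxx andbT in ne.
rewrite h subrr eqxx ltxx /= !subr_gt0.
by case: ltgtP.
Qed.

Lemma far_axis d z : far d z -> `|z.2| < d -> (d <= z.1) || (z.1 <= - d).
Proof.
by rewrite /far => /orP[|h]; rewrite ?ltNge ?h ?ler_normr //; move: z => [x y] /=; lra.
Qed.

(** Vectors close to a change of half-plane are close to the horizontal axis. *)
Lemma upper_change d a b c : nearby d a b -> nearby d a c -> nearby d b c ->
  upper b != upper c -> `|a.2| < d.
Proof.
case: a b c => [x y] [x' y'] [x2 y2] /andP[_ +] /andP[_ +] /andP[_ +].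
rewrite /upper /= !ltr_norml => /andP[h1 h2] /andP[h3 h4] /andP[h5 h6].
by have [hy|hy|hy] := ltgtP 0 y'; have [hy'|hy'|hy'] := ltgtP 0 y2 => //= _; lra.
Qed.

Lemma same_side d a b : 0 < d -> far d a -> far d b -> nearby d a b ->
  `|a.2| < d -> `|b.2| < d -> (0 < a.1) = (0 < b.1).
Proof.
move=> d0 fa fb + /(far_axis fa) ha /(far_axis fb) hb.
rewrite /nearby !ltr_norml => ?; apply/idP/idP; lra.
Qed.

Lemma nearbyC d a b : nearby d a b = nearby d b a.
Proof. by rewrite /nearby distrC [in X in _ && X]distrC. Qed.

Lemma nearbyxx d a : 0 < d -> nearby d a a.
Proof. by move=> d0; rewrite /nearby !subrr normr0 d0. Qed.

(** A small closed quadrilateral far from the origin crosses the positive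
    horizontal axis an even number of times. *)
Lemma cuts_quad d a b c e : 0 < d ->
  far d a -> far d b -> far d c -> far d e ->
  {in [:: a; b; c; e] &, forall z w, nearby d z w} ->
  cuts a b (+) cuts b c (+) cuts c e (+) cuts e a = false.
Proof.
move=> d0 fa fb fc fe nr.
have [/hasP[z zs /hasP[w ws zw]]|/hasPn sm] :=
  boolP (has (fun z => has (fun w => upper z != upper w) [:: a; b; c; e])
    [:: a; b; c; e]).
  have ax t : t \in [:: a; b; c; e] -> `|t.2| < d.
    by move=> ts; apply: (upper_change (nr t z _ _) (nr t w _ _) (nr z w _ _) zw).
  have sd t : t \in [:: a; b; c; e] -> far d t -> (0 < t.1) = (0 < a.1).
    move=> ts ft; apply: (same_side d0 ft fa _ (ax _ ts) (ax _ _));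
    by rewrite ?nr // inE eqxx.
  rewrite /cuts (sd b) ?(sd c) ?(sd e) ?inE ?eqxx ?orbT //.
  by case: (0 < a.1); case: (upper a) (upper b) (upper c) (upper e) => [] [] [] [].
have eu t t' : t \in [:: a; b; c; e] -> t' \in [:: a; b; c; e] -> upper t (+) upper t' = false.
  move=> ts ts'; have /hasPn/(_ _ ts') := sm _ ts.
  by rewrite negbK => /eqP->; rewrite addbb.
by rewrite /cuts !eu ?inE ?eqxx ?orbT.
Qed.

Lemma cutsC d a b : 0 < d -> far d a -> far d b -> nearby d a b ->
  cuts a b = cuts b a.
Proof.
move=> d0 fa fb nab; rewrite /cuts [upper b (+) _]addbC.
have [->|ne] := eqVneq (upper a) (upper b); first by rewrite addbb.
have nba : nearby d b a by rewrite nearbyC.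
have nn := nearbyxx _ d0.
by rewrite (same_side d0 fa fb nab) // ?(upper_change (nn a) nab nab)
           ?(upper_change nba (nn b) nab).
Qed.

(** Opposite steps count the crossings of the negative horizontal axis, and
    together both axes account for all changes of half-plane. *)
Lemma cuts_opp d a b : 0 < d -> far d a -> far d b -> nearby d a b ->
  cuts (- a) (- b) = cuts a b (+) upper a (+) upper b.
Proof.
move=> d0 fa fb nab.
have nz t : far d t -> t != 0.
  by apply: contraTneq => ->; rewrite /far /= normr0 orbb -ltNge.
have uN t : far d t -> upper (- t) = ~~ upper t.
  by move=> /nz; rewrite eq_sym => /upperB; rewrite subr0 sub0r => ->; rewrite negbK.
rewrite /cuts !uN // addbN addNb negbK.
have [->|ne] := eqVneq (upper a) (upper b); first by rewrite addbb; case: (upper b).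
have := far_axis fa (upper_change (nearbyxx a d0) nab nab ne).
case: a {fa nab} ne => [x y] /= + h; have [|] := ltP 0 x => hx.
  have -> : 0 < - x = false by lra.
  by case: (upper _); case: (upper _).
have -> : 0 < - x by lra.
by case: (upper _); case: (upper _).
Qed.
End Parity.

Section Grid.
Local Open Scope ring_scope.
Variable R : realFieldType.
Implicit Types (d : R) (a b : R * R) (s t : nat -> R * R).

Lemma far_sub d a b : far d (a - b) = far d (b - a).
Proof. by rewrite /far /= distrC [in X in _ || X]distrC. Qed.

Lemma far_le d d' a : d <= d' -> far d' a -> far d a.
Proof. by move=> dd /orP[]/(le_trans dd) h; rewrite /far h ?orbT. Qed.

Lemma nearby_sub d a a' b b' :
  nearby (d / 2) a a' -> nearby (d / 2) b b' -> nearby d (b - a) (b' - a').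
Proof.
case: a a' b b' => [? ?] [? ?] [? ?] [? ?].
rewrite /nearby /= !ltr_norml => /andP[] /andP[? ?] /andP[? ?] /andP[] /andP[? ?] /andP[? ?].
lra.
Qed.

(** The parity of the number of times the direction from [a] to a point running
    through [s 0, ..., s m] crosses the positive horizontal axis. *)
Definition turns a s m := \big[addb/false]_(i < m) cuts (s i - a) (s i.+1 - a).

Lemma addb_telescope (f : nat -> bool) m :
  \big[addb/false]_(i < m) (f i (+) f i.+1) = f 0%N (+) f m.
Proof.
elim: m => [|m IH]; first by rewrite big_ord0 addbb.
by rewrite big_ord_recr /= IH -addbA addKb.
Qed.

(** The difference [t j - s i] around the boundary of the rectangle of indices
    has even crossing number, as the sum over all unit squares.  On two sides of
    the rectangle the roles of the moving and the fixed point are exchanged;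
    restoring them replaces vectors by their opposites and produces the
    right-hand side. *)
Lemma turns_quad d s m t n : 0 < d ->
  (forall i j, (i <= m)%N -> (j <= n)%N -> far d (t j - s i)) ->
  (forall i, (i < m)%N -> nearby (d / 2) (s i) (s i.+1)) ->
  (forall j, (j < n)%N -> nearby (d / 2) (t j) (t j.+1)) ->
  turns (s 0%N) t n (+) turns (s m) t n (+) (turns (t 0%N) s m (+) turns (t n) s m) =
  upper (s 0%N - t 0%N) (+) upper (s m - t 0%N) (+)
  (upper (s 0%N - t n) (+) upper (s m - t n)).
Proof.
move=> d0 st ss tt.
have d20 : 0 < d / 2 by lra.
pose h j i := cuts (t j - s i) (t j - s i.+1).
(* A side with [t j] fixed and [s] moving, up to opposite vectors. *)
have hE j : (j <= n)%N -> \big[addb/false]_(i < m) h j i =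
    turns (t j) s m (+) (upper (s 0%N - t j) (+) upper (s m - t j)).
  move=> jn; rewrite -(addb_telescope (fun i => upper (s i - t j))) -big_split /=.
  apply: eq_bigr => i _; rewrite /h -(opprB (s i)) -(opprB (s i.+1)) (cuts_opp d0) ?addbA //.
  - by rewrite far_sub st // ltnW.
  - by rewrite far_sub st.
  - by apply: nearby_sub; rewrite ?nearbyxx ?ss.
(* A strip of unit squares between [s i] and [s i.+1]. *)
have sq i : (i < m)%N -> turns (s i) t n (+) turns (s i.+1) t n = h 0%N i (+) h n i.
  move=> im; rewrite -(addb_telescope (h^~ i)) -big_split /=; apply: eq_bigr => j _.
  have jn := ltn_ord j; have im' := ltnW im; have jn' := ltnW jn.
  have ns : {in [:: s i; s i.+1] &, forall z w, nearby (d / 2) z w}.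
    move=> z w; rewrite !inE => /orP[]/eqP-> /orP[]/eqP->;
    by rewrite ?nearbyxx ?ss // nearbyC ss.
  have nt : {in [:: t j; t j.+1] &, forall z w, nearby (d / 2) z w}.
    move=> z w; rewrite !inE => /orP[]/eqP-> /orP[]/eqP->;
    by rewrite ?nearbyxx ?tt // nearbyC tt.
  have nb : {in [:: t j - s i; t j.+1 - s i; t j.+1 - s i.+1; t j - s i.+1] &,
      forall z w, nearby d z w}.
    move=> z w; rewrite !inE => /or4P[]/eqP-> /or4P[]/eqP->;
    by apply: nearby_sub; [apply: ns | apply: nt]; rewrite !inE eqxx ?orbT.
  have := cuts_quad d0 (st _ _ im' jn') (st _ _ im' jn) (st _ _ im jn) (st _ _ im jn') nb.
  rewrite [cuts _ (t j - s i.+1)](cutsC d0) ?st //; last by rewrite nb // !inE eqxx ?orbT.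
  rewrite [cuts _ (t j - s i)](cutsC d0) ?st //; last by rewrite nb // !inE eqxx ?orbT.
  by rewrite /h; do 4! case: cuts.
have := hE _ (leq0n n); have := hE _ (leqnn n).
have : turns (s 0%N) t n (+) turns (s m) t n =
    \big[addb/false]_(i < m) h 0%N i (+) \big[addb/false]_(i < m) h n i.
  rewrite -(addb_telescope (fun i => turns (s i) t n)) -big_split /=.
  by apply: eq_bigr => i _; exact: sq.
move=> -> -> ->.
by do 2! case: turns; do 4! case: upper.
Qed.

End Grid.

(** * The obstruction of van Kampen *)
Section Xor.
Variable T : eqType.

(** A sum modulo 2 in which each index occurs an even number of times vanishes. *)
Lemma big_addb_even (f : T -> bool) (r : seq T) :
  all (fun x => ~~ odd (count_mem x r)) r -> \big[addb/false]_(x <- r) f x = false.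
Proof.
move=> /allP ev; rewrite -big_undup_iterop_count /= big1_seq // => x /=.
rewrite mem_undup => /ev.
rewrite Monoid.iteropE; elim/ltn_ind: (count_mem x r) => -[|[|k]] //= IH.
by rewrite negbK => /IH; rewrite addKb; apply.
Qed.
End Xor.

(** Below, vertices are natural numbers, an edge is the pair of its ends and [D]
    lists the unordered pairs of independent edges, each in one order only. *)
Section Obstruction.
Implicit Types (D : seq ((nat * nat) * (nat * nat))).

(** For each pair of edges, each end of one edge taken with the other edge. *)
Definition vertex_edge_incidences D :=
  flatten [seq [:: (ef.1.1, ef.2); (ef.1.2, ef.2); (ef.2.1, ef.1); (ef.2.2, ef.1)] | ef <- D].

(** For each pair of edges, the pairs formed by one end of each. *)
Definition vertex_pairs D :=
  flatten [seq [:: (ef.1.1, ef.2.1); (ef.1.2, ef.2.1); (ef.1.1, ef.2.2); (ef.1.2, ef.2.2)] | ef <- D].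

Definition sort_pair (x : nat * nat) := if (x.1 < x.2)%N then x else (x.2, x.1).

(** The contributions of vertex-edge incidences and of unordered pairs of
    vertices cancel modulo 2, but the number of pairs listed in decreasing order
    is odd.  This expresses that every drawing in general position has an odd
    number of crossings between independent edges. *)
Definition van_kampen D : bool :=
  [&& all (fun x => ~~ odd (count_mem x (vertex_edge_incidences D))) (vertex_edge_incidences D),
      (let U := map sort_pair (vertex_pairs D) in all (fun x => ~~ odd (count_mem x U)) U)
    & odd (count (fun x => x.2 <= x.1)%N (vertex_pairs D))].

(** The system of parity equations which disjoint independent edges would
    satisfy has no solution: [N v e] stands for the crossing parity of [e] seen
    from [v], and [o] for a strict total order on the vertices. *)
Lemma van_kampen_parity D (N : nat -> nat * nat -> bool) (o : nat -> nat -> bool) :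
  van_kampen D ->
  (forall e f, (e, f) \in D -> N e.1 f (+) N e.2 f (+) (N f.1 e (+) N f.2 e) =
     o e.1 f.1 (+) o e.2 f.1 (+) (o e.1 f.2 (+) o e.2 f.2)) ->
  (forall xy, xy \in vertex_pairs D -> o xy.2 xy.1 = ~~ o xy.1 xy.2) ->
  False.
Proof.
case/and3P => /(big_addb_even (fun x => N x.1 x.2)) ev.
move=> /(big_addb_even (fun x => o x.1 x.2)) ou odU NE oC.
have : \big[addb/false]_(x <- vertex_edge_incidences D) N x.1 x.2 =
       \big[addb/false]_(x <- vertex_pairs D) o x.1 x.2.
  rewrite !big_flatten !big_map; apply: eq_big_seq => -[e f] /NE.
  rewrite !big_cons !big_nil /= !addbF => E.
  by move: E; rewrite -!addbA.
rewrite ev.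
have -> : \big[addb/false]_(x <- vertex_pairs D) o x.1 x.2 =
    \big[addb/false]_(x <- vertex_pairs D) ((x.2 <= x.1)%N (+)
      o (sort_pair x).1 (sort_pair x).2).
  apply: eq_big_seq => -[x y] /oC /= E; rewrite /sort_pair /=.
  by case: ltnP => //= _; rewrite E negbK.
rewrite big_split /= -(big_map sort_pair xpredT (fun x => o x.1 x.2)) ou addbF.
have -> // : \big[addb/false]_(i <- vertex_pairs D) (i.2 <= i.1)%N =
   odd (count (fun x => x.2 <= x.1)%N (vertex_pairs D)).
  elim: vertex_pairs => [|x s IH]; first by rewrite big_nil.
  by rewrite big_cons IH /= oddD oddb.
by rewrite odU.
Qed.

Definition K33_pairs : seq ((nat * nat) * (nat * nat)) :=
  [seq ef <- [seq (e, f) | e <- [seq (i, j) | i <- iota 0 3, j <- iota 3 3],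
                           f <- [seq (i, j) | i <- iota 0 3, j <- iota 3 3]]
   | (ef.1.1 < ef.2.1)%N && (ef.1.2 != ef.2.2)].

Definition K5_pairs : seq ((nat * nat) * (nat * nat)) :=
  [seq ef <- [seq (e, f) | e <- [seq (i, j) | i <- iota 0 5, j <- iota 0 5],
                           f <- [seq (i, j) | i <- iota 0 5, j <- iota 0 5]]
   | [&& ef.1.1 < ef.1.2, ef.2.1 < ef.2.2, ef.1.1 < ef.2.1
      & uniq [:: ef.1.1; ef.1.2; ef.2.1; ef.2.2]]%N].

Lemma van_kampen_K33 : van_kampen K33_pairs. Proof. by vm_compute. Qed.
Lemma van_kampen_K5 : van_kampen K5_pairs. Proof. by vm_compute. Qed.
End Obstruction.

(** * Drawings of the complete graphs K_{3,3} and K_5 *)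
Section Plane.
Local Open Scope classical_set_scope.
Local Open Scope ring_scope.
Variable R : realType.
Local Notation plane := (R * R)%type.
Implicit Types (A B S : set plane) (a b : plane).

Lemma nearby_ballE e (x y : plane) : nearby e x y <-> ball x e y.
Proof.
have bE (u v : R) : ball u e v <-> `|u - v| < e by rewrite -ball_normE.
split; first by case/andP => /bE h1 /bE h2.
by case=> /bE h1 /bE h2; apply/andP.
Qed.

Lemma far_nearby e (x y : plane) : far e (y - x) = ~~ nearby e x y.
Proof. by rewrite far_sub /far /nearby negb_and -!leNgt. Qed.

Lemma nearby_trans e e' (x y z : plane) : nearby e x y -> nearby e' y z -> nearby (e + e') x z.
Proof.
case: x y z => [? ?] [? ?] [? ?].
by rewrite /nearby /= !ltr_norml => /andP[/andP[? ?] /andP[? ?]] /andP[/andP[? ?] /andP[? ?]]; lra.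
Qed.

Lemma nearby_le e e' (x y : plane) : e <= e' -> nearby e x y -> nearby e' x y.
Proof. by move=> le /andP[h1 h2]; rewrite /nearby !(lt_le_trans _ le). Qed.

Lemma plane_compact_closed A : compact A -> closed A.
Proof. by apply: compact_closed; exact: norm_hausdorff. Qed.

Lemma closed_far B a : closed B -> ~ B a -> exists2 e, 0 < e & forall b, B b -> ~~ nearby e a b.
Proof.
move=> cB Ba; have : nbhs a (~` B) by apply: open_nbhs_nbhs; split => //; exact: closed_openC.
move=> /nbhs_ballP[e /= e0 eB]; exists e => // b Bb; apply/negP => /nearby_ballE /eB; exact.
Qed.

Lemma compact_far A B : compact A -> compact B -> A `&` B = set0 ->
  exists2 d, 0 < d & forall a b, A a -> B b -> far d (b - a).
Proof.
move=> cA /plane_compact_closed cB AB.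
have := (compact_near_coveringP A).1 cA _ (0%R^'+ : set_system R)
  (fun e x => forall b, B b -> far e (b - x)) _.
case.
  move=> a Aa; have Ba : ~ B a by move=> Ba; have : (A `&` B) a by []; rewrite AB.
  have [e e0 eB] := closed_far cB Ba.
  have e20 : 0 < e / 2 by lra.
  exists (ball a (e / 2), [set t | t < e / 2]).
    by split => /=; [exact: nbhsx_ballx|exact: nbhs_right_lt].
  move=> [x t] [/= /nearby_ballE ax te] b Bb; rewrite far_nearby; apply/negP => xb.
  have /negP := eB _ Bb; apply; have := nearby_trans ax xb; apply: nearby_le; lra.
move=> d /= d0 H; exists (d / 2); first by lra.
move=> a b Aa Bb; apply: (H (d / 2)) => //=; last by lra.
by rewrite /ball_ /= sub0r normrN gtr0_norm; lra.
Qed.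

(** Any two points of a connected set are joined by a chain of points of the set
    with steps as small as desired. *)
Lemma connected_chain S a b e : connected S -> S a -> S b -> 0 < e ->
  exists n (s : nat -> plane), [/\ s 0%N = a, s n = b, forall i, (i <= n)%N -> S (s i) &
    forall i, (i < n)%N -> nearby e (s i) (s i.+1)].
Proof.
move=> cS Sa Sb e0.
pose B := [set b | S b /\ exists n (s : nat -> plane), [/\ s 0%N = a, s n = b,
    forall i, (i <= n)%N -> S (s i) & forall i, (i < n)%N -> nearby e (s i) (s i.+1)]].
have step x y : B x -> S y -> nearby e x y -> B y.
  case=> Sx [n [s [s0 sn sS sN]]] Sy xy; split => //.
  exists n.+1, (fun i => if (i <= n)%N then s i else y); split.
  - by rewrite leq0n.
  - by rewrite ltnn.
  - by move=> i _; case: ifP => // /sS.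
  - move=> i; rewrite ltnS => ile; rewrite ile; case: ltnP => [/sN //|ni].
    by rewrite (_ : i = n) ?sn //; apply/eqP; rewrite eqn_leq ile ni.
suff BS : S `<=` B by have [] := BS _ Sb.
suff -> : B = S by [].
apply: cS.
- exists a; split => //; exists 0%N, (fun=> a); split => // i.
- exists (\bigcup_(x in B) ball x e).
    apply: bigcup_open => x _; exact: ball_open.
  apply/seteqP; split => x.
    by move=> Bx; split; [case: Bx|exists x => //; exact: ballxx].
  by move=> [Sx [y By /nearby_ballE]]; exact: step.
- exists (~` (\bigcup_(x in S `\` B) ball x e)).
    by apply: open_closedC; apply: bigcup_open => x _; exact: ball_open.
  apply/seteqP; split => x.
    move=> Bx; split; first by case: Bx.
    move=> [y [Sy nBy] /nearby_ballE]; rewrite nearbyC => yx; exact/nBy/(step x).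
  move=> [Sx nx]; apply: contrapT => nBx; apply: nx; exists x => //; exact: ballxx.
Qed.

(** A graph with an odd van Kampen number cannot be drawn with points [p] as
    vertices and connected compact sets [S] as edges so that independent edges
    are disjoint. *)
Theorem van_kampen_obstruction (D : seq ((nat * nat) * (nat * nat)))
    (p : nat -> plane) (S : nat -> nat -> set plane) : van_kampen D ->
  (forall e f, (e, f) \in D -> forall g, g \in [:: e; f] ->
     [/\ connected (S g.1 g.2), compact (S g.1 g.2), S g.1 g.2 (p g.1) & S g.1 g.2 (p g.2)]) ->
  (forall e f, (e, f) \in D -> S e.1 e.2 `&` S f.1 f.2 = set0) -> False.
Proof.
move=> vk SP SD.
(* A common lower bound for the distances between independent edges. *)
have [d d0 dP] : exists2 d, 0 < d & forall e f, (e, f) \in D -> forall x y,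
    S e.1 e.2 x -> S f.1 f.2 y -> far d (y - x).
  elim: D SP SD {vk} => [|[e f] D IH] SP SD; first by exists 1.
  have [d d0 dP] : exists2 d, 0 < d & forall e f, (e, f) \in D -> forall x y,
    S e.1 e.2 x -> S f.1 f.2 y -> far d (y - x).
    by apply: IH => g h gh; [apply: SP|apply: SD]; rewrite inE gh orbT.
  have ef : (e, f) \in (e, f) :: D by rewrite inE eqxx.
  have [||d' d'0 d'P] := compact_far _ _ (SD _ _ ef).
    by have [] := SP _ _ ef e; rewrite ?inE ?eqxx ?orbT.
    by have [] := SP _ _ ef f; rewrite ?inE ?eqxx ?orbT.
  exists (Num.min d d'); first by rewrite lt_min d0.
  move=> g h; rewrite inE => /orP[/eqP[-> ->]|gh] x y gx hy.
    by apply: far_le (d'P _ _ gx hy); rewrite ge_min lexx orbT.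
  by apply: far_le (dP _ _ gh _ _ gx hy); rewrite ge_min lexx.
have d20 : 0 < d / 2 by lra.
(* Chains with steps shorter than [d / 2] replace the sets. *)
have /choice[c cP] : forall g : nat * nat, exists ns : nat * (nat -> plane),
    (exists2 ef, ef \in D & g \in [:: ef.1; ef.2]) ->
    [/\ ns.2 0%N = p g.1, ns.2 ns.1 = p g.2, forall i, (i <= ns.1)%N -> S g.1 g.2 (ns.2 i) &
    forall i, (i < ns.1)%N -> nearby (d / 2) (ns.2 i) (ns.2 i.+1)].
  move=> g; have [[[e f] ef gef]|nef] := pselect (exists2 ef, ef \in D & g \in [:: ef.1; ef.2]).
    have [cS _ S1 S2] := SP _ _ ef g gef.
    by have [n [s sP]] := connected_chain cS S1 S2 d20; exists (n, s).
  by exists (0%N, fun=> 0) => /nef.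
apply: (@van_kampen_parity D (fun v g => turns (p v) (c g).2 (c g).1)
  (fun x y => upper (p x - p y))) => //.
  move=> e f ef.
  have [|e0 en eS eN] := cP e; first by exists (e, f); rewrite // inE eqxx.
  have [|f0 fn fS fN] := cP f; first by exists (e, f); rewrite // !inE eqxx orbT.
  rewrite -e0 -en -f0 -fn; apply: turns_quad d0 _ _ _ => // i j ile jle.
  by apply: (dP _ _ ef); [exact: eS|exact: fS].
move=> xy /flatten_mapP[[e f] ef xyef].
have : p xy.1 != p xy.2.
  have [_ _ e1 e2] := SP _ _ ef e ltac:(by rewrite inE eqxx).
  have [_ _ f1 f2] := SP _ _ ef f ltac:(by rewrite !inE eqxx orbT).
  suff [] : S e.1 e.2 (p xy.1) /\ S f.1 f.2 (p xy.2).
    move=> h1 h2; apply/eqP => E; rewrite E in h1.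
    by have : (S e.1 e.2 `&` S f.1 f.2) (p xy.2) by []; rewrite SD.
  by move: xyef; rewrite !inE => /or4P[]/eqP->.
exact: upperB.
Qed.

Lemma K33_nonplanar (a b : nat -> plane) (S : nat -> nat -> set plane) :
  (forall i j, (i < 3)%N -> (j < 3)%N ->
    [/\ connected (S i j), compact (S i j), S i j (a i) & S i j (b j)]) ->
  (forall i j k l, (i < k < 3)%N -> (j < 3)%N -> (l < 3)%N -> j != l ->
     S i j `&` S k l = set0) -> False.
Proof.
move=> SP SD.
have D e f : (e, f) \in K33_pairs -> exists i j k l,
   [/\ (i < k < 3)%N, (j < 3)%N, (l < 3)%N & j != l] /\ e = (i, 3 + j)%N /\ f = (k, 3 + l)%N.
  rewrite mem_filter => /andP[ef /allpairsP[ef' [e'P f'P [E F]]]].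
  move: ef; rewrite {}E {}F; case/allpairsP: e'P => -[i j] [_ + ->].
  case/allpairsP: f'P => -[k l] [+ + ->].
  rewrite !mem_iota => /= k3 /andP[l3 l6] /andP[j3 j6] /andP[ik jl].
  exists i, (j - 3)%N, k, (l - 3)%N; rewrite !subnKC //; split=> //; split.
  - by rewrite ik.
  - by rewrite ltn_subLR.
  - by rewrite ltn_subLR.
  - by apply: contraNneq jl => /(congr1 (addn 3)); rewrite !subnKC // => ->.
(* The vertices of the second part are numbered 3, 4, 5. *)
pose q n := if (n < 3)%N then a n else b (n - 3)%N.
have q1 i : (i < 3)%N -> q i = a i by rewrite /q => ->.
have q2 j : q (3 + j)%N = b j by rewrite /q ltnNge leq_addr addKn.
apply: (van_kampen_obstruction (p := q) (S := fun i j => S i (j - 3)%N) van_kampen_K33).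
  move=> e f /D[i [j [k [l [[/andP[ik k3] j3 l3 _] [-> ->]]]]]] g.
  rewrite !inE => /orP[]/eqP-> /=; rewrite q1 ?q2 ?addKn ?(ltn_trans ik k3) //;
    apply: SP => //; exact: ltn_trans k3.
by move=> e f /D[i [j [k [l [[ik j3 l3 jl] [-> ->]]]]]]; rewrite !addKn; exact: SD.
Qed.

Lemma K5_nonplanar (a : nat -> plane) (S : nat -> nat -> set plane) :
  (forall i j, (i < j < 5)%N ->
    [/\ connected (S i j), compact (S i j), S i j (a i) & S i j (a j)]) ->
  (forall i j k l, (i < j < 5)%N -> (k < l < 5)%N -> (i < k)%N -> uniq [:: i; j; k; l] ->
     S i j `&` S k l = set0) -> False.
Proof.
move=> SP SD.
have D e f : (e, f) \in K5_pairs ->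
   [/\ (e.1 < e.2 < 5)%N, (f.1 < f.2 < 5)%N, (e.1 < f.1)%N & uniq [:: e.1; e.2; f.1; f.2]].
  rewrite mem_filter => /andP[ef /allpairsP[ef' [e'P f'P [E F]]]].
  move: ef; rewrite {}E {}F; case/allpairsP: e'P => -[i j] [_ + ->].
  case/allpairsP: f'P => -[k l] [_ + ->].
  by rewrite !mem_iota /= => -> -> /and4P[-> -> -> ->].
apply: (van_kampen_obstruction (p := a) (S := S) van_kampen_K5).
  move=> e f /D[he hf _ _] g; rewrite !inE => /orP[]/eqP->; exact: SP.
move=> e f /D[*]; exact: SD.
Qed.
End Plane.

(** * Reaching points of a region by compact sets *)
Section Segments.
Local Open Scope classical_set_scope.
Local Open Scope ring_scope.
Variable R : realType.
Local Notation plane := (R * R)%type.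
Implicit Types (A B C K : set plane).

Definition segment (x y : plane) : set plane := (fun t : R => x + t *: (y - x)) @` `[0, 1].

Lemma segment_start x y : segment x y x.
Proof. by exists 0; rewrite ?scale0r ?addr0 //= in_itv /= lexx ler01. Qed.
Lemma segment_end x y : segment x y y.
Proof. by exists 1; rewrite ?scale1r ?subrKC //= in_itv /= lexx ler01. Qed.

Lemma segment_continuous (x y : plane) : continuous (fun t : R => x + t *: (y - x)).
Proof.
by move=> t; apply: cvgD; [exact: cvg_cst|apply: cvgZr_tmp; exact: cvg_id].
Qed.

Lemma connected_segment x y : connected (segment x y).
Proof.
apply: connected_continuous_connected; first exact: segment_connected.
exact/continuous_subspaceT/segment_continuous.
Qed.

Lemma compact_segment x y : compact (segment x y).
Proof.
apply: continuous_compact; last exact: segment_compact.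
exact/continuous_subspaceT/segment_continuous.
Qed.

Lemma conv_nearby (e c u v t : R) : 0 <= t -> t <= 1 ->
  `|c - u| < e -> `|c - v| < e -> `|c - (u + t * (v - u))| < e.
Proof.
rewrite !ltr_norml => t0 t1 /andP[a1 a2] /andP[b1 b2]; apply/andP.
by have [uv|vu] := leP u v; split; nra.
Qed.

Lemma segment_nearby e c x y z : nearby e c x -> nearby e c y -> segment x y z -> nearby e c z.
Proof.
move=> /andP[cx1 cx2] /andP[cy1 cy2] [t + <-].
rewrite /= in_itv /= => /andP[t0 t1].
by apply/andP; split; exact: conv_nearby.
Qed.

(** In the complement of a closed set, two points of one component lie in a
    common connected compact subset: the set of points so reachable from [q] is
    open and closed in the component, since small segments stay in the
    complement. *)
Lemma component_reach K q x : closed K -> connected_component (~` K) q x ->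
  exists C, [/\ connected C, compact C, C q, C x & C `<=` ~` K].
Proof.
move=> cK qx.
have Kq : (~` K) q.
  by apply: contrapT => nq; move: qx; rewrite connected_component_out.
pose B := [set x | exists C, [/\ connected C, compact C, C q, C x & C `<=` ~` K]].
have BK : B `<=` ~` K by move=> y [C [_ _ _ Cy]]; apply.
have rad y : (~` K) y -> exists2 e, 0 < e & forall z, nearby e y z -> (~` K) z.
  move=> Ky; have [e e0 eP] := closed_far cK Ky.
  by exists e => // z yz Kz; move/negP: (eP _ Kz).
have step e y z w : (forall z, nearby e y z -> (~` K) z) ->
    nearby e y z -> nearby e y w -> B z -> B w.
  move=> eP yz yw [C [C1 C2 C3 C4 C5]]; exists (C `|` segment z w); split.
  - by apply: connectedU => //; [exists z; split => //; exact: segment_start|exact: connected_segment].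
  - by apply: compactU => //; exact: compact_segment.
  - by left.
  - by right; exact: segment_end.
  - by move=> t [/C5 //|/(segment_nearby yz yw)]; exact: eP.
suff CB : connected_component (~` K) q `&` B = connected_component (~` K) q.
  by have [_] : (connected_component (~` K) q `&` B) x by rewrite CB.
have opK : open (~` K) by exact: closed_openC.
have nb (y : plane) (e : R) : 0 < e -> nbhs y [set z | nearby e y z].
  by move=> e0; apply: (filterS _ (nbhsx_ballx y e e0)) => z /nearby_ballE.
apply: (component_connected (x := q) (A := ~` K)).
- exists q; split; first exact: connected_component_refl.
  exists [set q]; split => //; [exact: connected1|exact: compact_set1|by move=> _ ->].
- exists B => //; rewrite openE => y By; have [e e0 eP] := rad y (BK _ By).
  apply: (filterS _ (nb y e e0)) => z yz; apply: (step e y y z) => //; exact: nearbyxx.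
- exists (~` (~` K `\` B)); last first.
    apply/seteqP; split => y [Fy].
      by move=> By; split=> // -[].
    move=> nB; split => //; apply: contrapT => nBy; apply: nB; split => //.
    exact: connected_component_sub Fy.
  apply: open_closedC; rewrite openE => y [Ky nBy]; have [e e0 eP] := rad y Ky.
  apply: (filterS _ (nb y e e0)) => z yz; split; first exact: eP.
  by move=> Bz; apply: nBy; apply: (step e y z y) => //; exact: nearbyxx.
Qed.
End Segments.

(** * Forbidden subgraphs of outerplanar graphs *)
Section Walks.
Local Open Scope classical_set_scope.
Local Open Scope ring_scope.
Variables (R : realType) (G : sgraph).
Local Notation plane := (R * R)%type.
Variables (p : G -> plane) (arc : G -> G -> set plane).
Hypothesis emb : planar_embedding p arc.

(** The part of the drawing covered by the walk [u :: s]. *)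
Fixpoint walk_set (u : G) (s : seq G) : set plane :=
  if s is x :: s' then arc u x `|` walk_set x s' else [set p u].

Lemma arc_props x y : adj x y ->
  [/\ connected (arc x y), compact (arc x y), arc x y (p x) & arc x y (p y)].
Proof.
case: emb => _ arcP _ _ /arcP[_ [f [fc _ f0 f1 ->]]]; split.
- by apply: connected_continuous_connected; first exact: segment_connected.
- by apply: continuous_compact; last exact: segment_compact.
- by exists 0; rewrite //= in_itv /= lexx ler01.
- by exists 1; rewrite //= in_itv /= lexx ler01.
Qed.

Lemma walk_set_start u s : path (@adj G) u s -> walk_set u s (p u).
Proof. by case: s => //= x s /andP[/arc_props[_ _ ? _] _]; left. Qed.

Lemma walk_set_end u s : path (@adj G) u s -> walk_set u s (p (last u s)).
Proof. by elim: s u => //= x s IH u /andP[_ /IH ?]; right. Qed.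

Lemma walk_set_compact u s : path (@adj G) u s -> compact (walk_set u s).
Proof.
elim: s u => /= [|x s IH] u; first by move=> _; exact: compact_set1.
by case/andP=> /arc_props[_ ? _ _] /IH; exact: compactU.
Qed.

Lemma walk_set_connected u s : path (@adj G) u s -> connected (walk_set u s).
Proof.
elim: s u => /= [|x s IH] u; first by move=> _; exact: connected1.
case/andP=> /arc_props[? _ _ ux] xs; apply: connectedU => //; last exact: IH.
by exists (p x); split=> //; exact: walk_set_start.
Qed.

(** A point of the drawing of a walk either is a vertex of the walk or lies on
    an edge of the walk. *)
Lemma walk_setP u s z : path (@adj G) u s -> walk_set u s z ->
  (exists2 x, x \in u :: s & z = p x) \/
  exists x y, [/\ adj x y, x \in u :: s, y \in u :: s & arc x y z].
Proof.
elim: s u => /= [|x s IH] u; first by move=> _ ->; left; exists u; rewrite ?inE ?eqxx.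
case/andP => ux xs [uxz|/(IH x xs)].
  by right; exists u, x; rewrite !inE !eqxx orbT.
case=> [[y ys ->]|[y [y' [yy' ys y's yz]]]]; [left|right].
  by exists y; rewrite // inE ys orbT.
by exists y, y'; rewrite ![_ \in u :: _]in_cons ys y's !orbT.
Qed.

Lemma arc_vertex x y z : adj x y -> arc x y (p z) -> z \in [:: x; y].
Proof.
by case: emb => _ _ vP _ xy /(vP _ _ _ xy)[]->; rewrite !inE eqxx ?orbT.
Qed.

Lemma walk_set_disjoint u s u' s' : path (@adj G) u s -> path (@adj G) u' s' ->
  ~~ has (mem (u :: s)) (u' :: s') -> walk_set u s `&` walk_set u' s' = set0.
Proof.
move=> us us' dis; have D x : x \in u :: s -> x \in u' :: s' -> False.
  by move=> xs xs'; move/hasPn: dis => /(_ x xs') /negP; apply.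
have [pI arcP vP cP] := emb.
have D2 x y z : adj x y -> arc x y (p z) -> x \in u :: s -> y \in u :: s -> z \in u :: s.
  by move=> xy /(vP _ _ _ xy)[]->.
have D2' x y z : adj x y -> arc x y (p z) -> x \in u' :: s' -> y \in u' :: s' -> z \in u' :: s'.
  by move=> xy /(vP _ _ _ xy)[]->.
apply/seteqP; split => // z [/(walk_setP us) zs /(walk_setP us') zs'].
case: zs => [[x xs zx]|[x [y [xy xs ys zxy]]]];
case: zs' => [[x' xs' zx']|[x' [y' [xy' xs' ys' zxy']]]].
- by apply: (D x) => //; rewrite (pI x x') // -zx.
- by subst z; apply: (D x) => //; exact: D2' zxy' _ _.
- by subst z; apply: (D x') => //; exact: D2 zxy _ _.
have [w _ wz] : range p z.
  apply: (cP _ _ _ _ xy xy' _ z) => // /(congr1 (fun A : {set G} => x \in A)).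
  rewrite !inE eqxx /= => /esym /orP[]/eqP E; apply: (D x) => //; by rewrite E.
by subst z; apply: (D w); [exact: D2 zxy _ _|exact: D2' zxy' _ _].
Qed.

Lemma arc_closed x y : adj x y -> closed (arc x y).
Proof. by move=> /arc_props[_ /plane_compact_closed]. Qed.

Lemma drawing_closed : closed (drawing p arc).
Proof.
apply: closedU.
  rewrite -(_ : \bigcup_(v in [set: G]) [set p v] = range p).
    apply: closed_bigcup => [|v _]; first exact: finite_finset.
    by apply: plane_compact_closed; exact: compact_set1.
  by apply/seteqP; split=> [z [v _ ->]|z [v _ <-]]; exists v.
rewrite -(_ : \bigcup_(e in [set e : G * G | adj e.1 e.2]) arc e.1 e.2 =
    [set q | exists x y, adj x y /\ arc x y q]).
  by apply: closed_bigcup => [|e]; [exact: finite_finset|exact: arc_closed].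
apply/seteqP; split=> [z [[x y] /= xy ?]|z [x [y [xy ?]]]]; first by exists x, y.
by exists (x, y).
Qed.

(** From a point [q] of the region [F] every vertex is reached by a connected
    compact set disjoint from all walks that avoid this vertex. *)
Lemma outer_hub F : is_region p arc F -> (forall v, closure F (p v)) ->
  exists q (Q : G -> set plane), forall v,
  [/\ connected (Q v), compact (Q v), Q v q, Q v (p v) & forall u s, path (@adj G) u s ->
      v \notin u :: s -> Q v `&` walk_set u s = set0].
Proof.
case=> q _ -> clF; exists q.
suff /choice[Q QP] : forall v, exists Qv : set plane,
    [/\ connected Qv, compact Qv, Qv q, Qv (p v) & forall u s, path (@adj G) u s ->
      v \notin u :: s -> Qv `&` walk_set u s = set0] by exists Q.
move=> v.
have [pI arcP vP cP] := emb.
(* All vertices other than [v] and all edges not incident to [v]; near [v], the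
   last piece of the way to [v] only has to avoid [K]. *)
pose K := \bigcup_(w in [set w | w != v]) [set p w] `|`
  \bigcup_(e in [set e : G * G | [&& adj e.1 e.2, v != e.1 & v != e.2]]) arc e.1 e.2.
have cK : closed K.
  apply: closedU.
    apply: closed_bigcup => [|w _]; first exact: finite_finset.
    by apply: plane_compact_closed; exact: compact_set1.
  apply: closed_bigcup => [|e /and3P[? _ _]]; [exact: finite_finset|exact: arc_closed].
have Kv : ~ K (p v).
  case=> [[w /= /eqP wv /pI]|[e /= /and3P[e1 v1 v2] /(arc_vertex e1)]]; first exact/nesym.
  by rewrite !inE (negPf v1) (negPf v2).
have [e e0 eP] := closed_far cK Kv.
have [z [zF pz]] := clF v _ (nbhsx_ballx (p v) e e0).
have [C [C1 C2 C3 C4 C5]] := component_reach drawing_closed zF.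
have pz' : nearby e (p v) z by apply/nearby_ballE.
exists (C `|` segment z (p v)); split.
- by apply: connectedU => //; [exists z; split => //; exact: segment_start|exact: connected_segment].
- by apply: compactU => //; exact: compact_segment.
- by left.
- by right; exact: segment_end.
move=> u s us vs; apply/seteqP; split => // t [tQ /(walk_setP us) tw].
have nv x : x \in u :: s -> v != x by apply: contraTneq => <-.
have [Dt Kt] : drawing p arc t /\ K t.
  case: tw => [[x xs ->]|[x [y [xy xs ys txy]]]]; split.
  - by left; exists x.
  - by left; exists x => //=; rewrite eq_sym nv.
  - by right; exists x, y.
  - by right; exists (x, y); rewrite //= xy !nv.
case: tQ => [/C5 //|tseg].
by have /negP := eP _ Kt; apply; exact: segment_nearby pz' (nearbyxx _ e0) tseg.
Qed.
End Walks.

Section Forbidden.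
Local Open Scope classical_set_scope.
Local Open Scope ring_scope.
Variables (R : realType) (G : sgraph).
Hypothesis outer : outerplanar R G.

(** Two vertices [u] and [v] cannot be joined by three internally disjoint paths
    with nonempty interiors [s1], [s2], [s3].  Otherwise [u], [v] and the hub on
    one side and the first interior vertices of the paths on the other side
    form a drawing of K_{3,3}. *)
Theorem no_theta (u v : G) (s1 s2 s3 : seq G) :
  s1 != [::] -> s2 != [::] -> s3 != [::] ->
  path (@adj G) u (rcons s1 v) -> path (@adj G) u (rcons s2 v) ->
  path (@adj G) u (rcons s3 v) -> uniq (u :: v :: s1 ++ s2 ++ s3) -> False.
Proof.
move=> n1 n2 n3 p1 p2 p3.
rewrite 2!cons_uniq !cat_uniq in_cons !mem_cat !has_cat !negb_or.
case/and5P => /and4P[uv u1 u2 u3] /and3P[v1 v2 v3] _ /andP[/hasPn h12 /hasPn h13].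
case/and3P=> _ /hasPn h23 _.
move: s1 s2 s3 n1 n2 n3 p1 p2 p3 u1 u2 u3 v1 v2 v3 h12 h13 h23.
move=> [//|x1 t1] [//|x2 t2] [//|x3 t3] _ _ _ p1 p2 p3 u1 u2 u3 v1 v2 v3 h12 h13 h23.
have [p [arc [emb [F reg clF]]]] := outer.
have [q [Q QP]] := outer_hub emb reg clF.
pose x j := nth u [:: x1; x2; x3] j.
pose t j := nth [::] [:: t1; t2; t3] j.
have pj j : (j < 3)%N -> path (@adj G) u (rcons (x j :: t j) v).
  by case: j => [|[|[|]]].
have xL j : x j \in x j :: t j by rewrite mem_head.
have [uL vL LD] : [/\ forall j, (j < 3)%N -> u \notin x j :: t j,
    forall j, (j < 3)%N -> v \notin x j :: t j &
    forall j l z, (j < 3)%N -> (l < 3)%N -> z \in x j :: t j -> z \in x l :: t l -> j = l].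
  split => //.
  - by move=> [|[|[|]]].
  - by move=> [|[|[|]]].
  - have bad (s s' : seq G) z j l : (forall y, y \in s' -> y \notin s) -> z \in s -> z \in s' -> j = l :> nat.
      by move=> H zs /H; rewrite zs.
    move=> [|[|[|]]] // [|[|[|]]] //= z _ _ zj zl;
    [exact: bad h12 zj zl|exact: bad h13 zj zl|exact: bad h12 zl zj
    |exact: bad h23 zj zl|exact: bad h13 zl zj|exact: bad h23 zl zj].
have Qux j l : (j < 3)%N -> (l < 3)%N -> j != l -> x l \notin [:: u; x j].
  move=> j3 l3 jl; rewrite !inE negb_or; apply/andP; split.
    by apply: contraNneq (uL l l3) => <-.
  by apply: contraNneq jl => E; apply/eqP/(LD _ _ (x l)) => //; rewrite E.
have Qxv j l : (j < 3)%N -> (l < 3)%N -> j != l -> x l \notin x j :: rcons (t j) v.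
  move=> j3 l3 jl; rewrite -rcons_cons mem_rcons inE negb_or; apply/andP; split.
    by apply: contraNneq (vL l l3) => <-.
  by apply: contraNN jl => E; apply/eqP/(LD _ _ (x l)).
have Dux j l : (j < 3)%N -> (l < 3)%N -> j != l ->
    ~~ has (mem [:: u; x j]) (x l :: rcons (t l) v).
  move=> j3 l3 jl; apply/hasPn => z; rewrite -rcons_cons mem_rcons inE.
  case/orP=> [/eqP->|zl]; rewrite !inE negb_or; apply/andP; split.
  - by rewrite eq_sym.
  - by apply: contraNneq (vL j j3) => ->.
  - by apply: contraNneq (uL l l3) => <-.
  - by apply: contraNneq jl => E; apply/eqP/(LD _ _ z) => //; rewrite E.
have ux j : (j < 3)%N -> path (@adj G) u [:: x j] by move=> /pj /= /andP[-> _].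
have xv j : (j < 3)%N -> path (@adj G) (x j) (rcons (t j) v) by move=> /pj /= /andP[].
pose W := walk_set p arc.
apply: (@K33_nonplanar R (nth q [:: p u; p v; q]) (p \o x)
  (fun i j => nth set0 [:: W u [:: x j]; W (x j) (rcons (t j) v); Q (x j)] i)).
  move=> [|[|[|]]] //= j _ j3.
  - have P := ux j j3; split.
    + exact (walk_set_connected emb P).
    + exact (walk_set_compact emb P).
    + exact (walk_set_start emb P).
    + exact (walk_set_end p arc P).
  - have P := xv j j3; split.
    + exact (walk_set_connected emb P).
    + exact (walk_set_compact emb P).
    + by have := walk_set_end p arc P; rewrite last_rcons.
    + exact (walk_set_start emb P).
  - by have [] := QP (x j).
have QD v' u' s' : path (@adj G) u' s' -> v' \notin u' :: s' -> W u' s' `&` Q v' = set0.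
  by rewrite setIC; case: (QP v') => _ _ _ _; apply.
move=> i j k l; case: i k => [|[|i]] [|[|[|k]]] /andP[] // _ _ j3 l3 jl.
- exact: (walk_set_disjoint emb (ux j j3) (xv l l3) (Dux j l j3 l3 jl)).
- exact: (QD _ _ _ (ux j j3) (Qux j l j3 l3 jl)).
- exact: (QD _ _ _ (xv j j3) (Qxv j l j3 l3 jl)).
Qed.

(** The four vertices and the hub would form a drawing of K_5. *)
Theorem no_K4 (a b c d : G) : adj a b -> adj a c -> adj a d -> adj b c -> adj b d ->
  adj c d -> False.
Proof.
move=> ab ac ad bc bd cd.
have [p [arc [emb [F reg clF]]]] := outer.
have [q [Q QP]] := outer_hub emb reg clF.
pose s := [:: a; b; c; d].
pose x := nth a s.
have adjx i j : (i < j < 4)%N -> adj (x i) (x j).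
  by case/andP; case: i j => [|[|[|[|i]]]] [|[|[|[|j]]]].
have us : uniq s.
  have ne (y z : G) : adj y z -> y != z by apply: contraTneq => ->; rewrite adj_irr.
  by rewrite /= !inE !negb_or !ne.
have neq i j : (i < 4)%N -> (j < 4)%N -> i != j -> x i != x j.
  by move=> i4 j4 ij; rewrite nth_uniq.
apply: (@K5_nonplanar R (fun i => if (i < 4)%N then p (x i) else q)
  (fun i j => if (j < 4)%N then walk_set p arc (x i) [:: x j] else Q (x i))).
  move=> i j /andP[ij j5]; have i4 : (i < 4)%N by exact: leq_trans ij _.
  rewrite i4; have [j4|_] := ltnP j 4; last by have [] := QP (x i).
  have P : path (@adj G) (x i) [:: x j] by rewrite /= adjx ?ij.
  split.
  - exact (walk_set_connected emb P).
  - exact (walk_set_compact emb P).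
  - exact (walk_set_start emb P).
  - exact (walk_set_end p arc P).
move=> i j k l /andP[ij j5] /andP[kl l5] ik un.
have i4 : (i < 4)%N by exact: leq_trans ij _.
have k4 : (k < 4)%N by exact: leq_trans kl _.
rewrite /= !inE !negb_or in un; case/and4P: un => /and3P[Nij Nik Nil] /andP[Njk Njl] Nkl _.
cbv beta; have [j4|j4] := ltnP j 4; have [l4|l4] := ltnP l 4.
- apply: (walk_set_disjoint emb).
  + by rewrite /= adjx ?ij.
  + by rewrite /= adjx ?kl.
  + by rewrite /= !inE !negb_or ![x k == _]eq_sym ![x l == _]eq_sym !neq.
- have [_ _ _ _ H] := QP (x k); rewrite setIC; apply: H; first by rewrite /= adjx ?ij.
  by rewrite !inE !negb_or ![x k == _]eq_sym !neq.
- have [_ _ _ _ H] := QP (x i); apply: H; first by rewrite /= adjx ?kl.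
  by rewrite !inE !negb_or !neq.
- by case/eqP: Njl; apply/eqP; rewrite eqn_leq (leq_trans _ l4) ?(leq_trans _ j4).
Qed.
End Forbidden.

(** * One-page book embeddings *)
Section Parabola.
Local Open Scope classical_set_scope.
Local Open Scope ring_scope.
Variable R : realType.
Local Notation plane := (R * R)%type.
Implicit Types (a b c d u : R).

(** The arc from [(a, 0)] to [(b, 0)] of the parabola with roots [a] and [b]; the
    sign condition places the abscissa between [a] and [b], in either order. *)
Definition parabola_arc a b : set plane :=
  [set z | z.2 = (z.1 - a) * (z.1 - b) /\ z.2 <= 0].

Lemma parabola_arcC a b : parabola_arc a b = parabola_arc b a.
Proof. by apply/seteqP; split=> z [E ?]; split=> //; rewrite E mulrC. Qed.

Lemma parabola_is_arc a b : a != b -> is_arc (parabola_arc a b) (a, 0) (b, 0).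
Proof.
move=> ab; have ab0 : b - a != 0 by rewrite subr_eq0 eq_sym.
pose h t := a + t * (b - a).
exists (fun t => (h t, (h t - a) * (h t - b))); split.
- apply: continuous_subspaceT => t.
  have hc : h t @[t --> t] --> h t.
    by apply: cvgD; [exact: cvg_cst|apply: cvgM; [exact: cvg_id|exact: cvg_cst]].
  have hq : (h t - a) * (h t - b) @[t --> t] --> (h t - a) * (h t - b).
    by apply: cvgM; (apply: cvgB; [exact: hc|exact: cvg_cst]).
  exact: (cvg_pair hc hq).
- by move=> s t _ _ [+ _] => /addrI /(mulIf ab0).
- by rewrite /h mul0r addr0 subrr mul0r.
- by rewrite /h mul1r subrKC subrr mulr0.
apply/seteqP; split=> [[u v] [/= E0 le0]|_ [t /= + <-]].
  exists ((u - a) / (b - a)); last by rewrite /= /h divfK // subrKC E0.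
  have E : u - a = (u - a) / (b - a) * (b - a) by rewrite divfK.
  rewrite /= in_itv /=; move: ((u - a) / (b - a)) E => t E.
  have {}E : u = a + t * (b - a) by rewrite -E subrKC.
  have pos : 0 < (b - a) ^+ 2 by rewrite exprn_even_gt0.
  have : t * (1 - t) * (b - a) ^+ 2 >= 0 by rewrite E0 E in le0; lra.
  by rewrite pmulr_lge0 // => ?; apply/andP; split; nra.
rewrite in_itv /= => /andP[t0 t1]; split => //=.
have pos : 0 <= (b - a) ^+ 2 by rewrite sqr_ge0.
have -> : (h t - a) * (h t - b) = - (t * (1 - t) * (b - a) ^+ 2) by rewrite /h; ring.
by rewrite oppr_le0; apply: mulr_ge0 => //; apply: mulr_ge0 => //; lra.
Qed.

(** Parabolas of distinct intervals that do not interleave meet on the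
    horizontal axis only. *)
Lemma parabola_cross a b c d (z : plane) : a < b -> c < d ->
  ~ (a < c < b /\ b < d) -> ~ (c < a < d /\ d < b) -> (a, b) != (c, d) ->
  parabola_arc a b z -> parabola_arc c d z -> z.2 = 0.
Proof.
case: z => u v ab cd nc1 nc2 ne [/= E v0] [/= E' _].
move: v0; rewrite le_eqVlt => /orP[/eqP //|v0]; exfalso.
have [au ub] : a < u /\ u < b by split; nra.
have [cu ud] : c < u /\ u < d by split; nra.
have [ac|ca|ac] := ltgtP a c.
- have bd : d <= b by rewrite leNgt; apply/negP => bd; apply: nc1; split => //; apply/andP; split; lra.
  nra.
- have bd : b <= d by rewrite leNgt; apply/negP => bd; apply: nc2; split => //; apply/andP; split; lra.
  nra.
- subst c; have : (u - a) * (b - d) = 0 by lra.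
  by move/eqP; rewrite mulf_eq0 !subr_eq0 gt_eqF //= => /eqP bd; rewrite bd eqxx in ne.
Qed.

Lemma connected_upper : connected [set z : plane | 0 < z.2].
Proof.
rewrite -(_ : \bigcup_(z in [set z : plane | 0 < z.2]) segment (0, 1) z = [set z | 0 < z.2]).
  apply: bigcup_connected; last by move=> z _; exact: connected_segment.
  by exists (0, 1) => z _; exact: segment_start.
apply/seteqP; split=> [_ [[x y] /= y0 [t + <-]]|z z0]; last by exists z => //; exact: segment_end.
rewrite /= in_itv /= => /andP[t0 t1].
change (0 < 1 + t * (y - 1)); nra.
Qed.

End Parabola.

Section BookEmbedding.
Local Open Scope classical_set_scope.
Local Open Scope ring_scope.

(** Vertices are placed on a line by [f], edges are drawn on one side of it, and
    the open half-plane on the other side lies in a region that touches every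
    vertex. *)
Theorem outerplanar_of_numbering (R : realType) (G : sgraph) (f : G -> R) :
  injective f ->
  (forall x y z w, adj x y -> adj z w -> f x < f z -> f z < f y -> f y < f w -> False) ->
  outerplanar R G.
Proof.
move=> fI nc; pose p v := (f v, 0 : R).
exists p, (fun x y => parabola_arc (f x) (f y)); split.
  split.
  - by move=> x y [/fI].
  - move=> x y xy; split; first exact: parabola_arcC.
    by apply: parabola_is_arc; apply: contraTneq xy => /fI ->; rewrite adj_irr.
  - move=> x y z xy [/= /esym/eqP + _].
    by rewrite mulf_eq0 !subr_eq0 => /orP[]/eqP/fI; [left|right].
  - have key x y z w q : adj x y -> adj z w -> [set x; y]%SET <> [set z; w]%SET ->
        f x < f y -> f z < f w -> parabola_arc (f x) (f y) q ->
        parabola_arc (f z) (f w) q -> range p q.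
      move=> xy zw ne fxy fzw qxy qzw; have q2 : q.2 = 0.
        apply: parabola_cross fxy fzw _ _ _ qxy qzw.
        + by case=> /andP[]; exact: nc.
        + by case=> /andP[]; exact: nc.
        + by apply/eqP => -[/fI xz /fI yw]; apply: ne; rewrite xz yw.
      case: qxy => [E _]; move: E; rewrite q2 => /esym/eqP.
      rewrite mulf_eq0 !subr_eq0 => /orP[]/eqP q1; [exists x|exists y] => //;
      by rewrite /p -q1 -q2 -surjective_pairing.
    (* Arcs do not depend on the order of the ends, so that both edges may be
       assumed to point to the right. *)
    have ord x y (q : R * R) (T : Prop) : adj x y -> parabola_arc (f x) (f y) q ->
        (forall x' y', adj x' y' -> f x' < f y' -> parabola_arc (f x') (f y') q ->
           [set x'; y']%SET = [set x; y]%SET -> T) -> T.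
      move=> xy qxy H; have [lt|lt|/fI E] := ltgtP (f x) (f y); first exact: H qxy _.
        by apply: (H y x) => //; [rewrite adj_sym|rewrite parabola_arcC|rewrite finset.setUC].
      by move: xy; rewrite E adj_irr.
    move=> x y z w xy zw ne q [qxy qzw].
    apply: (ord _ _ _ _ xy qxy) => x' y' xy' lxy qxy' Exy.
    apply: (ord _ _ _ _ zw qzw) => z' w' zw' lzw qzw' Ezw.
    by apply: (key x' y' z' w') => //; rewrite Exy Ezw.
have up : [set z : R * R | 0 < z.2] `<=` ~` drawing p (fun x y => parabola_arc (f x) (f y)).
  move=> z /= z0 [[v _ pz]|[x [y [_ [_]]]]]; last by rewrite leNgt z0.
  by move: z0; rewrite -pz ltxx.
exists (connected_component (~` drawing p (fun x y => parabola_arc (f x) (f y))) (0, 1)).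
  by exists (0, 1) => //; apply: up => /=.
move=> v B /nbhs_ballP[e /= e0 eB]; exists (f v, e / 2); split.
  apply: (connected_component_max _ up); [by rewrite /=|exact: connected_upper|by rewrite /=; lra].
apply: eB; apply/nearby_ballE; rewrite /nearby /= subrr normr0 e0 sub0r normrN gtr0_norm; lra.
Qed.

End BookEmbedding.

(** * Common neighbours in outerplanar graphs *)
Section Common.
Variables (R : realType) (G : sgraph).
Hypothesis outer : outerplanar R G.
Local Notation cn := common_nbrs.
Implicit Types (u v w x y z a b c : G) (s : seq G).

Lemma adj_neq x y : adj x y -> x != y.
Proof. by apply: contraTneq => ->; rewrite adj_irr. Qed.

Lemma adj_neq_sym x y : adj x y -> y != x.
Proof. by rewrite eq_sym; exact: adj_neq. Qed.

Lemma mem_common_nbrs u v x : (x \in cn u v) = adj u x && adj v x.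
Proof. by rewrite inE. Qed.

Lemma common_nbrsC u v : cn u v = cn v u.
Proof. by apply/setP => x; rewrite !mem_common_nbrs andbC. Qed.

(** The theta formed by two common neighbours [x] and [y] of [u] and [v] and a
    further path from [u] to [v] with interior [s]. *)
Lemma no_theta_with_hats u v x y s : u != v -> x != y ->
  adj u x -> adj v x -> adj u y -> adj v y ->
  path (@adj G) u (rcons s v) -> uniq s -> s != [::] ->
  [&& u \notin s, v \notin s, x \notin s & y \notin s] -> False.
Proof.
move=> uv xy ux vx uy vy us un s0 /and4P[u1 v1 x1 y1].
apply: (@no_theta R G outer u v [:: x] [:: y] s) => //=; rewrite ?ux ?uy /=.
- by rewrite adj_sym vx.
- by rewrite adj_sym vy.
by rewrite !inE !negb_or uv (adj_neq ux) (adj_neq uy) u1 (adj_neq vx) (adj_neq vy) v1 xy x1 y1.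
Qed.

Lemma card_common_nbrs_le2 u v : u != v -> #|cn u v| <= 2.
Proof.
move=> uv; rewrite leqNgt; apply/negP => /card_gt2P[x [y [z [[+ + +] [xy yz zx]]]]].
rewrite !mem_common_nbrs => /andP[ux vx] /andP[uy vy] /andP[uz vz].
apply: (@no_theta_with_hats u v x y [:: z]) => //=; rewrite ?uz ?[adj z v]adj_sym ?vz //.
by rewrite !inE !(adj_neq uz) (adj_neq vz) eq_sym zx yz.
Qed.

(** Two distinct common neighbours of [u] and [v] are all of them. *)
Lemma common_nbrs_third u v x y z : u != v -> x != y -> adj u x -> adj v x -> adj u y ->
  adj v y -> adj u z -> adj v z -> (z == x) || (z == y).
Proof.
move=> uv xy ux vx uy vy uz vz; apply/norP => -[zx zy].
have := card_common_nbrs_le2 uv; apply/negP; rewrite -ltnNge; apply/card_gt2P.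
exists x, y, z; rewrite !mem_common_nbrs ux vx uy vy uz vz; split => //; split => //.
by rewrite eq_sym.
Qed.

End Common.

(** A property inherited by neighbours holds everywhere if it holds somewhere. *)
Lemma connected_invariant (G : sgraph) (A : pred G) (x0 : G) : connected_graph G -> A x0 ->
  (forall x y, A x -> adj x y -> A y) -> forall y, A y.
Proof.
move=> [_ con] A0 AS y; have /connectP[s + ->] := con x0 y.
elim: s x0 A0 => //= x s IH z Az /andP[zx xs]; apply: IH xs; exact: AS zx.
Qed.

(** * Graphs in which any two vertices have exactly one common neighbour *)
Section FriendshipGraphs.
Variables (R : realType) (G : sgraph).
Hypothesis outer : outerplanar R G.
Local Notation cn := common_nbrs.
Implicit Types (u v w x y z a b c : G) (s : seq G).
Hypothesis one : forall u v, u != v -> #|cn u v| = 1.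

Lemma unique_common_nbr u v : u != v -> exists2 x, adj u x /\ adj v x &
  forall y, adj u y -> adj v y -> y = x.
Proof.
move=> /one/eqP/cards1P[x E]; exists x.
  by apply/andP; rewrite -mem_common_nbrs E inE.
move=> y uy vy; have : y \in cn u v by rewrite mem_common_nbrs uy.
by rewrite E inE => /eqP.
Qed.

Lemma common_nbr_unique u v x y : u != v -> adj u x -> adj v x -> adj u y -> adj v y -> x = y.
Proof.
by move=> /unique_common_nbr[z _ zP] *; rewrite (zP x) // (zP y).
Qed.

(** A vertex [x] that misses some vertex [y] lies in just one triangle, the one
    containing the common neighbour [k] of [x] and [y].  A second triangle
    [x, z, t] would yield a theta between [x] and [y]: through [k], through [z]
    and the common neighbour of [z] and [y], and through [t] and the common
    neighbour of [t] and [y]. *)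
Lemma friendship_degree2 x y : x != y -> ~~ adj x y -> exists k v,
  [/\ adj x k, adj x v, k != v, adj k v & forall z, adj x z -> (z == k) || (z == v)].
Proof.
move=> xy nxy; have [k [xk yk] _] := unique_common_nbr xy.
have [v [xv kv] _] := unique_common_nbr (adj_neq xk).
have kNv := adj_neq kv.
exists k, v; split => // z xz; apply/norP => -[zk zv].
have [t [xt zt] _] := unique_common_nbr (adj_neq xz).
have zt' := adj_neq zt.
have tk : t != k.
  apply: contra_neq zv => E; subst t.
  by apply: (common_nbr_unique (adj_neq xk)) => //; rewrite adj_sym.
have tv : t != v.
  apply: contra_neq zk => E; subst t.
  by apply: (common_nbr_unique (adj_neq xv)) => //; rewrite adj_sym.
have far w : adj x w -> w != y by apply: contraTneq => ->.
have [m [zm ym] _] := unique_common_nbr (far z xz).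
have [n [tn yn] _] := unique_common_nbr (far t xt).
have yx : ~~ adj y x by rewrite adj_sym.
have mx : m != x by apply: contraTneq ym => ->.
have nx : n != x by apply: contraTneq yn => ->.
have nbr_k w : adj x w -> adj y w -> w = k by move=> xw yw; exact: (common_nbr_unique xy).
have mn : m != n.
  apply: contra_neq mx => E; subst n.
  by apply: (common_nbr_unique zt') => //; rewrite adj_sym.
have mk : m != k.
  apply: contra_neq zv => E; subst m.
  by apply: (common_nbr_unique (adj_neq xk)) => //; rewrite adj_sym.
have nk : n != k.
  apply: contra_neq tv => E; subst n.
  by apply: (common_nbr_unique (adj_neq xk)) => //; rewrite adj_sym.
have mt : m != t by apply: contra_neq tk => E; subst m; exact: nbr_k.
have nz : n != z by apply: contra_neq zk => E; subst n; exact: nbr_k.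
apply: (@no_theta R G outer x y [:: z; m] [:: t; n] [:: k]) => //=;
  rewrite ?xz ?zm ?xt ?tn ?xk ?[adj _ y]adj_sym ?ym ?yn ?yk //.
rewrite !inE !negb_or xy !(adj_neq xz, adj_neq xt, adj_neq xk, adj_neq ym, adj_neq yn, adj_neq yk) //=.
rewrite ![x == _]eq_sym mx nx ![y == _]eq_sym !far //= zt' (adj_neq zm) (adj_neq tn).
by rewrite [z == n]eq_sym nz zk mt mn mk tk nk.
Qed.

(** If every vertex missed another one, all degrees would be two, and then a
    vertex at distance two from [x0] would be a third neighbour of a neighbour of
    [x0]. *)
Lemma friendship_universal (x0 : G) : exists c, forall x, x != c -> adj c x.
Proof.
apply: contrapT => nu.
have nonuniv x : exists2 y, x != y & ~~ adj x y.
  apply: contrapT => H; apply: nu; exists x => y yx.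
  by apply: contrapT => /negP nxy; apply: H; exists y; rewrite // eq_sym.
have tri x k v : adj x k -> adj x v -> k != v -> forall z, adj x z -> (z == k) || (z == v).
  move=> xk xv kv z xz; have [y xy nxy] := nonuniv x.
  have [k' [v' [_ _ _ _ H]]] := friendship_degree2 xy nxy.
  case/orP: (H _ xk) kv => /eqP->; case/orP: (H _ xv) => /eqP->; rewrite ?eqxx // => _;
  by have := H _ xz; rewrite 1?orbC.
have [y xy nxy] := nonuniv x0.
have [k [v [xk xv kv akv xz]]] := friendship_degree2 xy nxy.
have [w [xw yw] _] := unique_common_nbr xy.
have : (y == k) || (y == v) || (y == x0).
  move: yw; rewrite adj_sym; case/orP: (xz _ xw) => /eqP-> yw.
    have := tri k x0 v _ akv (adj_neq xv) y yw.
    by rewrite adj_sym => /(_ xk) /orP[]->; rewrite ?orbT.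
  have := tri v x0 k _ _ (adj_neq xk) y yw.
  by rewrite adj_sym => /(_ xv); rewrite adj_sym => /(_ akv) /orP[]->; rewrite ?orbT.
by case/orP=> [/orP[]|]/eqP E; move: xy nxy; rewrite E ?xk ?xv ?eqxx.
Qed.
End FriendshipGraphs.

(** * Graphs in which any two vertices have zero or two common neighbours *)
Section ZeroTwoGraphs.
Variables (R : realType) (G : sgraph).
Hypothesis outer : outerplanar R G.
Local Notation cn := common_nbrs.
Implicit Types (u v w x y z a b c : G) (s : seq G).
Hypothesis two : forall u v, u != v -> #|cn u v| = 0 \/ #|cn u v| = 2.

Lemma second_common_nbr a b u : a != b -> adj a u -> adj b u ->
  exists y, [/\ y != u, adj a y, adj b y & forall z, adj a z -> adj b z -> (z == u) || (z == y)].
Proof.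
move=> ab au bu; have uP : u \in cn a b by rewrite mem_common_nbrs au.
case: (two ab) => [/cards0_eq E|/eqP/cards2P[x [y [xy E]]]]; first by rewrite E inE in uP.
have inP z : (adj a z && adj b z) = (z == x) || (z == y) by rewrite -mem_common_nbrs E !inE.
have := inP u; rewrite au bu => /esym/orP[]/eqP uE; subst u.
  by exists y; have := inP y; rewrite eqxx orbT => /andP[-> ->]; split=> //;
    [rewrite eq_sym|move=> z az bz; rewrite -inP az].
exists x; have := inP x; rewrite eqxx => /andP[-> ->]; split=> // z az bz.
by rewrite orbC -inP az.
Qed.

(** Two triangles [u, c, a] and [u, c, b] on a common edge.  As there is no [K_4],
    [a] and [b] are not adjacent, so the edges [c a] and [c b] lie in further triangles with apexes [y3]
    and [y2] outside; the second common neighbour [f] of [y2] and [y3] then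
    completes a theta between [a] and [b] through [u], [c] and [y3, f, y2]. *)
Lemma zero_two_no_diamond u a b c : a != b -> adj u a -> adj u b -> adj u c ->
  adj c a -> adj c b -> False.
Proof.
move=> ab ua ub uc ca cb.
have [ab'|nab] := boolP (adj a b).
  by apply: (no_K4 outer ua ub uc ab'); rewrite adj_sym.
have [au bu ac bc cu] : [/\ adj a u, adj b u, adj a c, adj b c & adj c u].
  by split; rewrite adj_sym.
have [y2 [y2u by2 cy2 _]] := second_common_nbr (adj_neq bc) bu cu.
have [y3 [y3u ay3 cy3 _]] := second_common_nbr (adj_neq ac) au cu.
have cnuc z : adj u z -> adj c z -> (z == a) || (z == b).
  by move=> uz cz; apply: (common_nbrs_third outer (adj_neq uc)).
have cnab z : adj a z -> adj b z -> (z == u) || (z == c).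
  by move=> az bz; apply: (common_nbrs_third outer ab (adj_neq uc)).
have nba : ~~ adj b a by rewrite adj_sym.
have y2a : y2 != a by apply: contraNneq nba => <-.
have y3b : y3 != b by apply: contraNneq nab => <-.
have ny2u : ~~ adj u y2.
  by apply/negP => /cnuc /(_ cy2); rewrite (negPf y2a) (negPf (adj_neq_sym by2)).
have ny3u : ~~ adj u y3.
  by apply/negP => /cnuc /(_ cy3); rewrite (negPf y3b) (negPf (adj_neq_sym ay3)).
have y2c := adj_neq_sym cy2; have y3c := adj_neq_sym cy3.
have y23 : y3 != y2.
  by apply/eqP => E; have := cnab y2; rewrite -{1}E ay3 by2 (negPf y2u) (negPf y2c) => /(_ isT isT).
have y2c' : adj y2 c by rewrite adj_sym.
have y3c' : adj y3 c by rewrite adj_sym.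
have [f [fc y3f y2f _]] := second_common_nbr y23 y3c' y2c'.
have fu : f != u by apply: contraNneq ny2u => <-; rewrite adj_sym.
have fa : f != a.
  apply/eqP => E; have := cnab y2; rewrite adj_sym -{1}E y2f by2 (negPf y2u) (negPf y2c).
  by move=> /(_ isT isT).
have fb : f != b.
  apply/eqP => E; have := cnab y3; rewrite [adj b _]adj_sym -{1}E y3f ay3 (negPf y3u) (negPf y3c).
  by move=> /(_ isT isT).
apply: (@no_theta_with_hats R G outer a b u c [:: y3; f; y2]) => //=.
- exact: adj_neq.
- by rewrite ay3 y3f [adj f _]adj_sym y2f adj_sym by2.
- by rewrite !inE negb_or (adj_neq y3f) y23 eq_sym (adj_neq y2f).
rewrite !inE !negb_or (adj_neq ay3) (adj_neq by2) ![_ == y3]eq_sym ![_ == f]eq_sym ![_ == y2]eq_sym.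
by rewrite fa y2a y3b fb y3u fu y2u y3c fc y2c.
Qed.

(** Given three neighbours [a], [b], [c] of [u], each two of them have a second
    common neighbour; unless a diamond appears these are distinct and new, and
    give a theta between [a] and [b] through [u], [y1] and [y3, c, y2]. *)
Lemma zero_two_degree_le2 u a b c : a != b -> a != c -> b != c ->
  adj u a -> adj u b -> adj u c -> False.
Proof.
move=> ab ac bc ua ub uc.
have [au bu cu] : [/\ adj a u, adj b u & adj c u] by rewrite ![adj _ u]adj_sym.
have [y1 [y1u ay1 by1 _]] := second_common_nbr ab au bu.
have [y2 [y2u by2 cy2 _]] := second_common_nbr bc bu cu.
have [y3 [y3u ay3 cy3 _]] := second_common_nbr ac au cu.
have y1c : y1 != c.
  by apply/eqP => E; subst; apply: (zero_two_no_diamond ab ua ub uc); rewrite adj_sym.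
have y2a : y2 != a.
  by apply/eqP => E; subst; apply: (zero_two_no_diamond bc ub uc ua); rewrite adj_sym.
have y3b : y3 != b.
  by apply/eqP => E; subst; apply: (zero_two_no_diamond ac ua uc ub); rewrite adj_sym.
have tri y : u != y -> adj a y -> adj b y -> adj c y -> False.
  move=> uy ay By cy; have := common_nbrs_third outer uy ab ua _ ub _ uc _.
  rewrite ![adj y _]adj_sym => /(_ ay By cy).
  by rewrite ![c == _]eq_sym (negPf ac) (negPf bc).
have y12 : y1 != y2.
  by apply/eqP => E; subst; apply: (tri y2) => //; rewrite eq_sym.
have y13 : y1 != y3.
  by apply/eqP => E; subst; apply: (tri y3) => //; rewrite eq_sym.
have y32 : y3 != y2.
  by apply/eqP => E; subst; apply: (tri y2) => //; rewrite eq_sym.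
apply: (@no_theta_with_hats R G outer a b u y1 [:: y3; c; y2]) => //=.
- by rewrite eq_sym.
- by rewrite ay3 [adj y3 c]adj_sym cy3 cy2 adj_sym by2.
- by rewrite !inE negb_or (adj_neq_sym cy3) y32 (adj_neq cy2).
rewrite !inE !negb_or (adj_neq ay3) (adj_neq by2) ![_ == y3]eq_sym ![_ == y2]eq_sym.
rewrite ac bc y2a y3b y3u (adj_neq uc) y2u y1c.
by rewrite ![_ == y1]eq_sym y13 y12.
Qed.

Hypothesis con : connected_graph G.

Lemma zero_two_square u v : u != v -> #|cn u v| = 2 -> isomorphic square_graph G.
Proof.
move=> uv /eqP/cards2P[a [b [ab E]]].
have [[ua va] [ub vb]] : (adj u a /\ adj v a) /\ (adj u b /\ adj v b).
  by split; apply/andP; rewrite -mem_common_nbrs E !inE eqxx ?orbT.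
have deg x y z t : y != z -> adj x y -> adj x z -> adj x t -> (t == y) || (t == z).
  move=> yz xy xz xt; apply/norP => -[ty tz].
  by apply: (zero_two_degree_le2 yz _ _ xy xz xt); rewrite eq_sym.
have [au av bu bv] : [/\ adj a u, adj a v, adj b u & adj b v].
  by rewrite ![adj a _]adj_sym ![adj b _]adj_sym.
have nuv : adj u v = false.
  by apply/negP => /(deg _ _ _ _ ab ua ub); rewrite (negPf (adj_neq va)) (negPf (adj_neq vb)).
have nab : adj a b = false.
  by apply/negP => /(deg _ _ _ _ uv au av); rewrite (negPf (adj_neq bu)) (negPf (adj_neq bv)).
have all4 : forall x, x \in [:: u; a; v; b].
  apply: (connected_invariant (x0 := u) con); first by rewrite inE eqxx.
  move=> x y; rewrite !inE => /or4P[]/eqP->.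
  - by move/(deg _ _ _ _ ab ua ub) => /orP[]->; rewrite ?orbT.
  - by move/(deg _ _ _ _ uv au av) => /orP[]->; rewrite ?orbT.
  - by move/(deg _ _ _ _ ab va vb) => /orP[]->; rewrite ?orbT.
  - by move/(deg _ _ _ _ uv bu bv) => /orP[]->; rewrite ?orbT.
have un : uniq [:: u; a; v; b].
  by rewrite /= !inE !negb_or uv ab !adj_neq.
exists (fun i : 'I_4 => nth u [:: u; a; v; b] i); split.
  apply: inj_card_bij.
    by move=> i j /eqP; rewrite nth_uniq // => /eqP/val_inj.
  rewrite [leqRHS](card_ord 4) cardE -[4]/(size [:: u; a; v; b]).
  by apply: uniq_leq_size; rewrite ?enum_uniq // => x _; rewrite all4.
case=> [[|[|[|[|i]]]] ?] [[|[|[|[|j]]]] ?] //=;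
  rewrite ?adj_irr ?ua ?ub ?va ?vb ?au ?av ?bu ?bv ?nuv ?nab //; by rewrite adj_sym ?nuv ?nab.
Qed.
End ZeroTwoGraphs.

(** * Lining up a linear forest *)
Section LinearForest.
Variables (T : finType) (e : rel T).
Hypothesis e_sym : symmetric e.
Implicit Types (A : {set T}) (x y z : T) (s : seq T).

(** Adjacent entries of the enumeration [s] occupy consecutive positions. *)
Definition neighbours_in_line s :=
  forall x y, x \in s -> e x y -> index x s < index y s -> index y s = (index x s).+1.

(** A finite graph of maximum degree at most two without cycles is a disjoint
    union of paths: its vertices can be lined up so that adjacent vertices are
    consecutive.  By the degree bound a longest path is a whole component, and
    by the absence of cycles it has no chords; the rest is lined up by
    induction. *)
Lemma linear_forest_enum A :
  (forall x y, x \in A -> e x y -> y \in A) ->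
  (forall x a b c, x \in A -> e x a -> e x b -> e x c -> a != b -> a != c -> b != c -> False) ->
  (forall x s, x \in A -> path e x s -> uniq (x :: s) -> 1 < size s -> e (last x s) x -> False) ->
  exists s, [/\ uniq s, s =i A & neighbours_in_line s].
Proof.
have [n] := ubnP #|A|; elim: n A => // n IH A; rewrite ltnS => cA clA degA acA.
have [->|[x0 x0A]] := set_0Vmem A.
  by exists [::]; split => [|x|x y] //; rewrite !inE.
pose P m := `[< exists x p, [/\ x \in A, path e x p, uniq (x :: p) & size p = m] >].
have exP : exists m, P m by exists 0; apply/asboolP; exists x0, [::].
have inA x p : x \in A -> path e x p -> {subset x :: p <= A}.
  elim: p x => /= [|y p IHp] x xA; first by move=> _ z; rewrite inE => /eqP->.
  case/andP=> xy yp z; rewrite inE => /orP[/eqP-> //|]; apply: IHp => //.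
  exact: clA xy.
have bdP m : P m -> m <= #|T|.
  move/asboolP => [x [p [_ _ /card_uniqP/= cp <-]]].
  by apply: ltnW; rewrite /= -cp; exact: max_card.
case: (ex_maxnP exP bdP) => m /asboolP[x [p [xA xp up <-]]] maxP.
set L := x :: p.
have LA : {subset L <= A} by exact: inA.
have eL i : i < size p -> e (nth x L i) (nth x L i.+1) by move/(pathP x): xp; apply.
(* A neighbour outside [L] would lengthen the path or be a third neighbour. *)
have outL z w : z \in L -> e z w -> w \in L.
  move=> zL zw; apply: contrapT => /negP wL.
  have wA : w \in A by apply: clA zw; exact: LA.
  have longer y q : y \in A -> path e y q -> uniq (y :: q) -> size q <= size p.
    by move=> *; apply: maxP; apply/asboolP; exists y, q.
  have [i iL zE] : exists2 i, i < size L & nth x L i = z by apply/nthP.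
  subst z; have i0 : 0 < i.
    rewrite lt0n; apply/eqP => E; subst i.
    have wp : path e w L by rewrite /= e_sym zw.
    have uw : uniq (w :: L) by rewrite cons_uniq wL.
    by have := longer w L wA wp uw; rewrite ltnn.
  have ip : i < size p.
    rewrite ltn_neqAle -ltnS iL andbT; apply/eqP => E; subst i.
    have wp : path e x (rcons p w) by rewrite rcons_path xp (last_nth x).
    have uw : uniq (x :: rcons p w) by rewrite -rcons_cons rcons_uniq wL.
    by have := longer x (rcons p w) xA wp uw; rewrite size_rcons ltnn.
  apply: (degA (nth x L i) (nth x L i.-1) (nth x L i.+1) w) => //.
  - exact: LA.
  - by rewrite e_sym; have := @eL i.-1; rewrite prednK //; apply; exact: ltnW.
  - exact: eL.
  - by rewrite nth_uniq ?(leq_ltn_trans (leq_pred _) iL) // neq_ltn ltnS leq_pred.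
  - by apply: contraNneq wL => <-; rewrite mem_nth //; apply: leq_ltn_trans (leq_pred _) iL.
  - by apply: contraNneq wL => <-; rewrite mem_nth.
(* Otherwise the path closes up to a cycle between positions [i] and [j]. *)
have consec i j : i < j < size L -> e (nth x L i) (nth x L j) -> j = i.+1.
  case/andP=> ij jL eij; apply/eqP; rewrite eqn_leq ij andbT leqNgt; apply/negP => ij2.
  have iL := ltn_trans ij jL.
  pose q := take (j - i) (drop i.+1 L).
  have qE : nth x L i :: q = take (j - i).+1 (drop i L) by rewrite (drop_nth x iL).
  have sq : size q = j - i.
    apply: succn_inj; rewrite -[LHS]/(size (nth x L i :: q)) qE size_take_min size_drop.
    by apply/minn_idPl; rewrite ltn_sub2r.
  apply: (acA (nth x L i) q).
  - exact/LA/mem_nth.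
  - by rewrite -[path _ _ _]/(sorted e (nth x L i :: q)) qE take_sorted // drop_sorted.
  - by rewrite qE take_uniq // drop_uniq.
  - by rewrite sq ltn_subRL addn1.
  - by rewrite (last_nth x) qE sq nth_take // nth_drop subnKC ?(ltnW ij) // e_sym.
pose A' := [set z in A | z \notin L].
have A'A z : z \in A' -> z \in A by rewrite inE => /andP[].
have [s [us sA sL]] : exists s, [/\ uniq s, s =i A' & neighbours_in_line s].
  apply: IH.
  - apply: leq_trans cA; apply: proper_card; apply/properP; split.
      by apply/fintype.subsetP.
    by exists x => //; rewrite inE mem_head andbF.
  - move=> z w; rewrite !inE => /andP[zA zL] zw; rewrite (clA z) //=.
    by apply: contra zL => wL; apply: outL wL _; rewrite e_sym.
  - by move=> z a b c /A'A; exact: degA.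
  - by move=> z q /A'A; exact: acA.
have sL' z : z \in s -> z \notin L by rewrite sA [_ \in A']inE => /andP[].
exists (L ++ s); split.
- by rewrite cat_uniq up us andbT; apply/hasPn.
- move=> z; rewrite mem_cat sA [z \in A']inE.
  by have := LA z; case: (z \in L) => [->|_] //; rewrite orFb andbT.
move=> y z; rewrite mem_cat !index_cat => yLs yz.
have [yL|yL] := boolP (y \in L).
  have zL := outL _ _ yL yz; rewrite zL => lt; apply: consec; last by rewrite !nth_index.
  by rewrite lt index_mem.
have zL : z \notin L by apply: contra yL => zL; apply: outL zL _; rewrite e_sym.
rewrite (negPf yL) /= in yLs; rewrite (negPf zL) ltn_add2l => lt.
by rewrite (sL y z yLs yz lt) addnS.
Qed.
End LinearForest.

(** * Graphs in which any two vertices have a common neighbour *)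
Section SquareChord.
Variables (R : realType) (G : sgraph).
Hypothesis outer : outerplanar R G.
Local Notation cn := common_nbrs.
Implicit Types (u v w x y z a b c : G) (s : seq G).
Hypothesis pos : forall u v, u != v -> 0 < #|cn u v|.

Lemma common_nbr_ex u v : u != v -> exists x, adj u x /\ adj v x.
Proof. by move=> /pos /card_gt0P[x]; rewrite mem_common_nbrs => /andP[]; exists x. Qed.

(** In a 4-cycle [v, x, w, y] at least one pair of opposite vertices is adjacent.
    Otherwise the apexes [x'] and [z] of triangles on the opposite edges [v x] and
    [w y] have a common neighbour [t], and [x', t, z] is a third path from [x] to
    [y] besides those through [v] and [w]. *)
Lemma square_chord v w x y : v != w -> x != y -> adj v x -> adj w x -> adj v y -> adj w y ->
  ~~ adj v w -> adj x y.
Proof.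
move=> vw xy vx wx vy wy nvw; apply: contrapT => /negP nxy.
have [xv [yw [xw yv]]] : adj x v /\ adj y w /\ adj x w /\ adj y v.
  by rewrite ![adj x _]adj_sym ![adj y _]adj_sym.
have [x' [x'v x'x]] := common_nbr_ex (adj_neq vx).
have [z [wz yz]] := common_nbr_ex (adj_neq wy).
have cnxy t : adj x t -> adj y t -> (t == v) || (t == w).
  by move=> ? ?; apply: (common_nbrs_third outer xy vw).
have cnvw t : adj v t -> adj w t -> (t == x) || (t == y).
  by move=> ? ?; apply: (common_nbrs_third outer vw xy).
have nwv : ~~ adj w v by rewrite adj_sym.
have nyx : ~~ adj y x by rewrite adj_sym.
have x'y : x' != y by apply: contraNneq nxy => <-.
have x'w : x' != w by apply: contraNneq nvw => <-.
have zx : z != x by apply: contraNneq nyx => <-.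
have zv : z != v by apply: contraNneq nwv => <-.
have nyx' : ~~ adj y x'.
  by apply/negP => /(cnxy _ x'x); rewrite (negPf x'w) (negPf (adj_neq_sym x'v)).
have nxz : ~~ adj x z.
  by apply/negP => /cnxy /(_ yz); rewrite (negPf zv) (negPf (adj_neq_sym wz)).
have nvz : ~~ adj v z.
  by apply/negP => /cnvw /(_ wz); rewrite (negPf zx) (negPf (adj_neq_sym yz)).
have nwx' : ~~ adj w x'.
  by apply/negP => /(cnvw _ x'v); rewrite (negPf x'y) (negPf (adj_neq_sym x'x)).
have x'z : x' != z by apply: contraNneq nxz => <-.
have [t [x't zt]] := common_nbr_ex x'z.
have tx : t != x by apply: contraNneq nxz => <-; rewrite adj_sym.
have ty : t != y by apply: contraNneq nyx' => <-; rewrite adj_sym.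
have tv : t != v by apply: contraNneq nvz => <-; rewrite adj_sym.
have tw : t != w by apply: contraNneq nwx' => <-; rewrite adj_sym.
apply: (@no_theta_with_hats R G outer x y v w [:: x'; t; z]) => //=.
- by rewrite x'x x't [adj t z]adj_sym zt adj_sym yz.
- by rewrite !inE negb_or (adj_neq x't) x'z (adj_neq_sym zt).
rewrite !inE !negb_or ![_ == x']eq_sym ![_ == t]eq_sym ![_ == z]eq_sym.
rewrite (adj_neq_sym x'x) tx zx x'y ty (adj_neq_sym yz).
by rewrite (adj_neq_sym x'v) tv zv x'w tw (adj_neq_sym wz).
Qed.
End SquareChord.

Lemma inj_surj_bij (A B : finType) (f : A -> B) : injective f -> (forall y, exists x, f x = y) -> bijective f.
Proof.
move=> fI /fin_all_exists[g gK]; exists g => // x; exact/fI/gK.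
Qed.

Lemma isomorphic_sym (G H : sgraph) : isomorphic G H -> isomorphic H G.
Proof.
case=> f [[g fK gK] fP]; exists g; split; first by exists f.
by move=> x y; rewrite -{2}(gK x) -{2}(gK y) fP.
Qed.

(** The remaining case is that no vertex is adjacent to all others.  The square
    [v, x, w, y] with the chord [x y] is then extended to the 3-sun. *)
Section Sun.
Variables (R : realType) (G : sgraph).
Hypothesis outer : outerplanar R G.
Local Notation cn := common_nbrs.
Implicit Types (t u v w x y z a b c : G) (s : seq G).
Hypothesis pos : forall u v, u != v -> 0 < #|cn u v|.

Section Diamond.
Variables v w x y : G.
Hypotheses (vw : v != w) (nvw : ~~ adj v w) (xy : adj x y).
Hypotheses (vx : adj v x) (wx : adj w x) (vy : adj v y) (wy : adj w y).

Let xv : adj x v. Proof. by rewrite adj_sym. Qed.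
Let xw : adj x w. Proof. by rewrite adj_sym. Qed.
Let yv : adj y v. Proof. by rewrite adj_sym. Qed.
Let yw : adj y w. Proof. by rewrite adj_sym. Qed.
Let yx : adj y x. Proof. by rewrite adj_sym. Qed.
Let nwv : ~~ adj w v. Proof. by rewrite adj_sym. Qed.

(** Every further vertex is adjacent to exactly one of [x] and [y]: not to both,
    as [v] and [w] already are common neighbours of [x] and [y], and not to
    none, as it would link [v] to [w] outside [x] and [y]. *)
Lemma diamond_cover t : t \notin [:: v; w; x; y] -> adj x t (+) adj y t.
Proof.
rewrite !inE !negb_or => /and4P[tv tw tx ty].
have vt : v != t by rewrite eq_sym.
have wt : w != t by rewrite eq_sym.
have cnvw r : adj v r -> adj w r -> (r == x) || (r == y).
  by move=> vr wr; apply: (common_nbrs_third outer vw (adj_neq xy)).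
have [/(common_nbrs_third outer (adj_neq xy) vw xv yv xw yw)|xt] := boolP (adj x t).
  move=> H; apply/negP => /H; by rewrite (negPf tv) (negPf tw).
apply: contrapT => /negP yt.
have [r [vr tr]] := common_nbr_ex pos vt; have [q [wq tq]] := common_nbr_ex pos wt.
have rx : r != x by apply: contraNneq xt => <-; rewrite adj_sym.
have ry : r != y by apply: contraNneq yt => <-; rewrite adj_sym.
have qx : q != x by apply: contraNneq xt => <-; rewrite adj_sym.
have qy : q != y by apply: contraNneq yt => <-; rewrite adj_sym.
have nwr : ~~ adj w r by apply/negP => /(cnvw _ vr); rewrite (negPf rx) (negPf ry).
have nvq : ~~ adj v q by apply/negP => /cnvw /(_ wq); rewrite (negPf qx) (negPf qy).
have rq : r != q by apply: contraNneq nvq => <-.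
have rw : r != w by apply: contraNneq nvw => <-.
have qv : q != v by apply: contraNneq nwv => <-.
apply: (@no_theta_with_hats R G outer v w x y [:: r; t; q]) => //=.
- exact: adj_neq.
- by rewrite vr [adj r t]adj_sym tr tq adj_sym wq.
- by rewrite !inE negb_or (adj_neq_sym tr) rq (adj_neq tq).
rewrite !inE !negb_or ![_ == r]eq_sym ![_ == q]eq_sym ![_ == t]eq_sym.
by rewrite (adj_neq_sym vr) tv qv rw tw (adj_neq_sym wq) rx tx qx ry ty qy.
Qed.

(** A path from [x] to [y] avoiding [v] and [w] must be the edge [x y], so that it
    cannot pass through [t] and [u]. *)
Lemma diamond_meet t u : t \notin [:: v; w; x; y] -> u \notin [:: v; w; x; y] ->
  adj x t -> adj y u -> [/\ ~~ adj t u & exists r, [/\ r \in [:: v; w], adj r t & adj r u]].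
Proof.
move=> tn un xt yu.
have yt : ~~ adj y t by have := diamond_cover tn; rewrite xt.
have xu : ~~ adj x u by have := diamond_cover un; rewrite yu addbT.
have tu : t != u by apply: contraNneq xu => <-.
move: tn un; rewrite !inE !negb_or => /and4P[tv tw tx ty] /and4P[uv uw ux uy].
split.
  apply/negP => atu; apply: (@no_theta_with_hats R G outer x y v w [:: t; u]) => //=.
  - exact: adj_neq.
  - by rewrite xt atu adj_sym yu.
  - by rewrite !inE tu.
  - by rewrite !inE !negb_or ![_ == t]eq_sym ![_ == u]eq_sym tx ux ty uy tv uv tw uw.
have [r [tr ur]] := common_nbr_ex pos tu; exists r; split; rewrite 1?adj_sym //.
apply: contrapT => /negP; rewrite !inE negb_or => /andP[rv rw].
have rx : r != x by apply: contraNneq xu => <-; rewrite adj_sym.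
have ry : r != y by apply: contraNneq yt => <-; rewrite adj_sym.
apply: (@no_theta_with_hats R G outer x y v w [:: t; r; u]) => //=.
- exact: adj_neq.
- by rewrite xt tr adj_sym ur adj_sym yu.
- by rewrite !inE negb_or (adj_neq tr) tu (adj_neq_sym ur).
rewrite !inE !negb_or ![_ == t]eq_sym ![_ == u]eq_sym ![_ == r]eq_sym.
by rewrite tx rx ux ty ry uy tv rv uv tw rw uw.
Qed.

(** A further neighbour of [x] and a further neighbour of [y], both adjacent to
    [v]: any additional vertex would be a third common neighbour of [v] and one
    of [x] and [y], so that the graph has just these six vertices.  The inner
    triangle of the sun is [v, x, y]. *)
Lemma diamond_sun t u : t \notin [:: v; w; x; y] -> u \notin [:: v; w; x; y] ->
  adj x t -> adj y u -> adj v t -> adj v u -> isomorphic sun_graph G.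
Proof.
move=> tn un xt yu vt vu.
have nyt : ~~ adj y t by have := diamond_cover tn; rewrite xt.
have nxu : ~~ adj x u by have := diamond_cover un; rewrite yu addbT.
have [ntu _] := diamond_meet tn un xt yu.
have cnvw r : adj v r -> adj w r -> (r == x) || (r == y).
  by move=> vr wr; apply: (common_nbrs_third outer vw (adj_neq xy)).
have tu : t != u by apply: contraNneq nxu => <-.
have [tv tw tx ty] : [/\ t != v, t != w, t != x & t != y].
  by move: tn; rewrite !inE !negb_or => /and4P.
have [uv uw ux uy] : [/\ u != v, u != w, u != x & u != y].
  by move: un; rewrite !inE !negb_or => /and4P.
have nwt : ~~ adj w t by apply/negP => /(cnvw _ vt); rewrite (negPf tx) (negPf ty).
have nwu : ~~ adj w u by apply/negP => /(cnvw _ vu); rewrite (negPf ux) (negPf uy).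
have all6 z : z \in [:: v; x; y; w; u; t].
  apply: contrapT => /negP; rewrite !inE !negb_or => /and5P[zv zx zy zw /andP[zu zt]].
  have zn : z \notin [:: v; w; x; y] by rewrite !inE !negb_or zv zw zx zy.
  have := diamond_cover zn; have [xz _|_ /= yz] := boolP (adj x z).
    have [_ [r [+ rz ru]]] := diamond_meet zn un xz yu.
    rewrite !inE => /orP[]/eqP E; subst r; last by rewrite ru in nwu.
    have := common_nbrs_third outer (adj_neq vx) ty vt xt vy xy rz xz.
    by rewrite (negPf zt) (negPf zy).
  have [_ [r [+ rt rz]]] := diamond_meet tn zn xt yz.
  rewrite !inE => /orP[]/eqP E; subst r; last by rewrite rt in nwt.
  have := common_nbrs_third outer (adj_neq vy) ux vu yu vx yx rz yz.
  by rewrite (negPf zu) (negPf zx).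
pose f (i : sun_graph) := match i with
  | inl i => nth v [:: v; x; y] i | inr j => nth v [:: w; u; t] j end.
have fP i j : adj (f i) (f j) = adj i j.
  have E : [/\ adj t x, adj t v, adj u y & adj u v] by rewrite ![adj t _]adj_sym ![adj u _]adj_sym.
  have N : [/\ ~~ adj t y, ~~ adj u x, ~~ adj t w, ~~ adj u w & ~~ adj u t].
    by rewrite ![adj t _]adj_sym ![adj u _]adj_sym.
  case: E N => e1 e2 e3 e4 [/negPf n1 /negPf n2 /negPf n3 /negPf n4 /negPf n5].
  case: i j => [[[|[|[|?]]] ?]|[[|[|[|?]]] ?]] [[[|[|[|?]]] ?]|[[|[|[|?]]] ?]] //=;
  by rewrite ?adj_irr ?e1 ?e2 ?e3 ?e4 ?n1 ?n2 ?n3 ?n4 ?n5 ?xy ?yx ?xv ?yv ?xw ?yw ?vx ?vy ?wx ?wy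
     ?(negPf nvw) ?(negPf nwv) ?(negPf nyt) ?(negPf nxu) ?(negPf ntu) ?(negPf nwt) ?(negPf nwu) ?xt ?yu ?vt ?vu.
exists f; split => //.
have un6 : uniq [:: v; x; y; w; u; t].
  rewrite /= !inE !negb_or vw (adj_neq vx) (adj_neq vy) (adj_neq xy) (adj_neq xw) (adj_neq yw).
  by rewrite ![_ == u]eq_sym ![_ == t]eq_sym uv ux uy uw tv tx ty tw tu.
have fE (i : sun_graph) : f i = nth v [:: v; x; y; w; u; t] (match i with inl i => i | inr j => 3 + j end).
  by case: i => [[[|[|[|?]]] ?]|[[|[|[|?]]] ?]].
apply: inj_surj_bij.
  move=> i j /eqP; rewrite !fE nth_uniq //; last 2 first.
  - by case: i => i /=; [apply: leq_trans (ltn_ord i) _|rewrite ltn_add2l (ltn_ord i)].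
  - by case: j => j /=; [apply: leq_trans (ltn_ord j) _|rewrite ltn_add2l (ltn_ord j)].
  case: i j => i [] j /= /eqP E.
  - by rewrite (ord_inj E).
  - by have := ltn_ord i; rewrite E.
  - by have := ltn_ord j; rewrite -E.
  - by congr inr; apply: ord_inj; exact: addnI E.
move=> z; have := all6 z; rewrite !inE => /or4P[|||/or3P[]] /eqP->.
- by exists (inl (inord 0)); rewrite /= inordK.
- by exists (inl (inord 1)); rewrite /= inordK.
- by exists (inl (inord 2)); rewrite /= inordK.
- by exists (inr (inord 0)); rewrite /= inordK.
- by exists (inr (inord 1)); rewrite /= inordK.
- by exists (inr (inord 2)); rewrite /= inordK.
Qed.
End Diamond.

Hypothesis nouniv : forall c, exists y, y != c /\ ~~ adj c y.

Lemma no_universal_sun u0 v0 : u0 != v0 -> 1 < #|cn u0 v0| -> isomorphic sun_graph G.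
Proof.
move=> uv /card_gt1P[x0 [y0 [+ + xy0]]]; rewrite !mem_common_nbrs => /andP[ux vx] /andP[uy vy].
(* Of the two pairs of opposite vertices of the 4-cycle exactly one is adjacent. *)
have [v [w [x [y [vw nvw xy [vx' wx' vy' wy']]]]]] : exists v w x y,
    [/\ v != w, ~~ adj v w, adj x y & [/\ adj v x, adj w x, adj v y & adj w y]].
  have [auv|nuv] := boolP (adj u0 v0); last first.
    exists u0, v0, x0, y0; split => //.
    exact: (square_chord outer pos uv xy0 ux vx uy vy).
  exists x0, y0, u0, v0; split => //; last by rewrite ![adj x0 _]adj_sym ![adj y0 _]adj_sym.
  by apply/negP => axy; apply: (no_K4 outer auv ux uy vx vy axy).
have [u [ux' nxu]] := nouniv x; have [t [ty nyt]] := nouniv y.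
have un : u \notin [:: v; w; x; y].
  rewrite !inE !negb_or ux' andTb; apply/and3P; split.
  - by apply: contraNneq nxu => ->; rewrite adj_sym.
  - by apply: contraNneq nxu => ->; rewrite adj_sym.
  - by apply: contraNneq nxu => ->.
have tn : t \notin [:: v; w; x; y].
  rewrite !inE !negb_or ty andbT; apply/and3P; split.
  - by apply: contraNneq nyt => ->; rewrite adj_sym.
  - by apply: contraNneq nyt => ->; rewrite adj_sym.
  - by apply: contraNneq nyt => ->; rewrite adj_sym.
have xt : adj x t by have := diamond_cover vw nvw xy vx' wx' vy' wy' tn; rewrite (negPf nyt) addbF.
have yu : adj y u by have := diamond_cover vw nvw xy vx' wx' vy' wy' un; rewrite (negPf nxu).
have [_ [r [+ rt ru]]] := diamond_meet vw nvw xy vx' wx' vy' wy' tn un xt yu.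
rewrite !inE => /orP[]/eqP E; subst r.
  exact: (diamond_sun vw nvw xy vx' wx' vy' wy' tn un xt yu rt ru).
apply: (@diamond_sun w v x y _ _ xy wx' vx' wy' vy' t u) => //; rewrite 1?eq_sym 1?adj_sym //.
  by move: tn; rewrite !inE !negb_or => /and4P[-> -> -> ->].
by move: un; rewrite !inE !negb_or => /and4P[-> -> -> ->].
Qed.
End Sun.

(** * Graphs with a vertex adjacent to all others *)
Section Induced.
Variables (G : sgraph) (P : pred G).
Definition induced_adj : rel {x : G | P x} := fun x y => adj (val x) (val y).
Fact induced_sym : symmetric induced_adj.
Proof. by move=> x y; exact: adj_sym. Qed.
Fact induced_irr : irreflexive induced_adj.
Proof. by move=> x; exact: adj_irr. Qed.
(** The subgraph induced on the vertices satisfying [P]. *)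
Definition induced_graph := SGraph induced_sym induced_irr.
End Induced.

Section Universal.
Variables (R : realType) (G : sgraph) (c : G).
Hypothesis outer : outerplanar R G.
Local Notation cn := common_nbrs.
Implicit Types (t u v w x y z a b : G) (s : seq G).
Hypothesis univ : forall x, x != c -> adj c x.
Hypothesis nontriv : exists x, x != c.

(** Deleting [c] leaves a linear forest: three neighbours of [x] besides [c]
    would be common neighbours of [x] and [c], and a cycle would form with [c] a [K_4] or a
    theta. *)
Lemma universal_family_R : (forall u v, u != v -> 0 < #|cn u v|) -> family_R G.
Proof.
(* The graph without [c], as a relation on all vertices. *)
move=> pos; pose e x y := [&& adj x y, x != c & y != c].
have eP x y : e x y -> [/\ adj x y, x != c & y != c] by move/and3P.
have [s [us sA sL]] : exists s, [/\ uniq s, s =i [set x | x != c] & neighbours_in_line e s].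
  apply: linear_forest_enum.
  - by move=> x y; rewrite /e adj_sym; congr (_ && _); rewrite andbC.
  - by move=> x y _ /eP[_ _]; rewrite inE.
  - move=> x a b d; rewrite inE => xc /eP[xa _ ac] /eP[xb _ bc] /eP[xd _ dc] ab ad bd.
    have := common_nbrs_third outer xc ab xa (univ ac) xb (univ bc) xd (univ dc).
    by rewrite ![d == _]eq_sym (negPf ad) (negPf bd).
  - move=> x s; rewrite inE => xc xs; have sP : path (@adj G) x s /\ all (fun y => y != c) s.
      elim: s (x) xs => //= y s IH z /andP[/eP[zy zc yc] /IH[-> ->]].
      by rewrite zy yc.
    case: s xs sP => [//|a [//|b s]] _ [] /= /and3P[xa ab bs] /and3P[ac bc sc].
    move=> /and4P[xn an bn un] _ /eP[lx _ _].
    have [xna xnb xns] : [/\ x != a, x != b & x \notin s].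
      by move: xn; rewrite !inE !negb_or => /and3P.
    have [anb ans] : a != b /\ a \notin s by move: an; rewrite inE negb_or => /andP.
    have cs : c \notin s by apply/negP => /(allP sc); rewrite eqxx.
    (* A triangle forms a [K_4] with [c]; in a longer cycle [x, a, b, d, ...] the
       vertices [b] and [x] are joined through [a], through [c] and along the
       remaining part of the cycle. *)
    case: s bs sc xn an bn un lx xns ans cs => [|d s] bs sc xn an bn un lx xns ans cs.
      by apply: (no_K4 outer (univ xc) (univ ac) (univ bc) xa _ ab); rewrite adj_sym.
    apply: (@no_theta_with_hats R G outer b x a c (d :: s)) => //.
    + by rewrite eq_sym.
    + by rewrite adj_sym.
    + by rewrite adj_sym; apply: univ.
    + by rewrite adj_sym; apply: univ.
    + by rewrite rcons_path bs.
    + by rewrite bn xns ans cs.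
pose H : sgraph := induced_graph (fun x => x != c).
have ls (x : H) : index (val x) s < (size s).+3.
  by rewrite ltnS (leq_trans (index_size _ _)) // -addn2 leq_addr.
exists (size s).+3; split => //; exists H; split.
- by have [x xc] := nontriv; apply/card_gt0P; exists (exist (fun x => x != c) x xc).
- exists (fun x : H => Ordinal (ls x)); split.
    move=> x y [/(congr1 (nth c s))]; rewrite !nth_index ?sA ?inE ?(valP x) ?(valP y) //.
    exact: val_inj.
  have half (x y : H) : adj x y -> index (val x) s < index (val y) s -> 
     index (val y) s = (index (val x) s).+1.
    by move=> xy; apply: sL; rewrite ?sA ?inE ?(valP x) // /e (xy : adj (val x) (val y)) (valP x) (valP y).
  move=> x y xy; rewrite /= /path_adj /=.
  have yx : adj y x by rewrite adj_sym.
  case: (ltngtP (index (val x) s) (index (val y) s)) => [/(half _ _ xy)->|/(half _ _ yx)->|E]; rewrite ?eqxx ?orbT //.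
  have : val x = val y.
    by rewrite -(nth_index c (_ : val x \in s)) ?E ?nth_index // sA inE ?(valP x) ?(valP y).
  by move=> /val_inj E'; move: xy; rewrite E' adj_irr.
- move=> x; have [y [xy cy]] := common_nbr_ex pos (valP x).
  by exists (exist (fun x => x != c) y (adj_neq_sym cy)).
apply: isomorphic_sym.
exists (fun z : join_graph H (complete_graph 1) => match z with inl x => val x | inr _ => c end).
split.
  apply: inj_surj_bij.
    move=> [x|i] [y|j] //.
    - by move=> /val_inj ->.
    - by move=> E; have := valP x; rewrite E eqxx.
    - by move=> E; have := valP y; rewrite -E eqxx.
    - by move=> _; rewrite (ord1 i) (ord1 j).
  move=> y; have [->|yc] := eqVneq y c; first by exists (inr ord0).
  by exists (inl (exist (fun x => x != c) y yc)).
move=> [x|i] [y|j] //=.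
- by rewrite adj_sym; apply: univ; exact: (valP x).
- by apply: univ; exact: (valP y).
- by rewrite adj_irr (ord1 i) (ord1 j) /complete_adj eqxx.
Qed.

(** The graph without [c] is a perfect matching.  The involution [sg] exchanges
    matched vertices, and in each matched pair the vertex of smaller rank is
    chosen to index the triangles. *)
Lemma universal_friendship : (forall u v, u != v -> #|cn u v| = 1) -> is_friendship G.
Proof.
move=> one.
have /fin_all_exists[sg sgP] : forall x, exists y, x != c ->
    [/\ adj x y, y != c & forall z, z != c -> adj x z -> z = y].
  move=> x; have [->|xc] := eqVneq x c; first by exists c.
  have [y [xy cy] yP] := unique_common_nbr one xc.
  by exists y => _; split => //; [exact: adj_neq_sym|move=> z zc xz; apply: yP => //; exact: univ].
have sgc x : x != c -> sg x != c by move=> /sgP[].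
have asg x y : x != c -> y != c -> adj x y = (y == sg x).
  move=> xc yc; have [xs _ H] := sgP x xc; apply/idP/eqP => [/H ->//|->//].
have sgK x : x != c -> sg (sg x) = x.
  move=> xc; have [xs _ _] := sgP x xc; apply/esym/eqP; rewrite -asg ?sgc //.
  by rewrite adj_sym.
pose r x : nat := enum_rank x.
have rI x y : r x = r y -> x = y by move=> /ord_inj/enum_rank_inj.
pose A := [set x | (x != c) && (r x < r (sg x))].
have AP x : x \in A -> x != c /\ r x < r (sg x) by rewrite inE => /andP.
have AsA x y : x \in A -> y \in A -> (y == sg x) = false.
  move=> /AP[xc lx] /AP[yc ly]; apply/negP => /eqP E; subst y.
  by move: ly; rewrite sgK // ltnNge ltnW.
have sgI x y : x != c -> y != c -> sg x = sg y -> x = y.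
  by move=> xc yc E; rewrite -(sgK x) // E sgK.
pose g (z : friendship_graph #|A|) := match z with
  | None => c | Some (i, b) => if b then sg (enum_val i) else enum_val i end.
have gc i (b : bool) : g (Some (i, b)) != c.
  have [ic _] := AP _ (enum_valP i); case: b => //=; exact: sgc.
exists #|A|; split.
  have [x xc] := nontriv; apply/card_gt0P.
  have [lt|lt|E] := ltngtP (r x) (r (sg x)).
  - by exists x; rewrite inE xc.
  - by exists (sg x); rewrite inE sgc // sgK.
  - have [xs _ _] := sgP x xc; have := adj_neq xs.
    by rewrite -(rI _ _ E) eqxx.
apply: isomorphic_sym; exists g; split.
  apply: inj_surj_bij.
    move=> [[i b]|] [[j d]|] //.
    - have [ic _] := AP _ (enum_valP i); have [jc _] := AP _ (enum_valP j).
      have D (i' j' : 'I_#|A|) : sg (enum_val i') = enum_val j' -> False.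
        move=> E; have := AsA _ _ (enum_valP i') (enum_valP j').
        by rewrite E eqxx.
      case: b d => [] [] /=.
      + by move=> /(sgI _ _ ic jc)/enum_val_inj ->.
      + by move=> /D.
      + by move=> /esym/D.
      + by move=> /enum_val_inj ->.
    - by move=> E; have := gc i b; rewrite E eqxx.
    - by move=> E; have := gc j d; rewrite -E eqxx.
  move=> y; have [->|yc] := eqVneq y c; first by exists None.
  have [lt|lt|E] := ltngtP (r y) (r (sg y)).
  - have yA : y \in A by rewrite inE yc.
    by exists (Some (enum_rank_in yA y, false)); rewrite /= enum_rankK_in.
  - have yA : sg y \in A by rewrite inE sgc // sgK.
    by exists (Some (enum_rank_in yA (sg y), true)); rewrite /= enum_rankK_in // sgK.
  - have [xs _ _] := sgP y yc; have := adj_neq xs.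
    by rewrite -(rI _ _ E) eqxx.
move=> [[i b]|] [[j d]|]; last by rewrite /= adj_irr.
- rewrite asg //; have [ic _] := AP _ (enum_valP i); have [jc _] := AP _ (enum_valP j).
  case: b d => [] [] /=; rewrite ?andbT ?andbF ?sgK //.
  + by rewrite eq_sym AsA // enum_valP.
  + by rewrite (inj_eq enum_val_inj) eq_sym.
  + apply/eqP/eqP => [/(sgI _ _ jc ic)/enum_val_inj ->//|->//].
  + by rewrite AsA // enum_valP.
- by rewrite /= adj_sym univ // gc.
- by rewrite univ // gc.
Qed.
End Universal.

(** * The graphs of the classification *)

(** No two edges interleave in the order of the numbers. *)
Definition noncrossing (G : sgraph) (f : G -> nat) :=
  injective f /\ forall x y z w, adj x y -> adj z w ->
    f x < f z -> f z < f y -> f y < f w -> False.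

Lemma noncrossing_outerplanar (R : realType) (G H : sgraph) (f : H -> nat) :
  isomorphic G H -> noncrossing f -> outerplanar R G.
Proof.
case=> h [/bij_inj hI hP] [fI nc].
apply: (@outerplanar_of_numbering R G (fun x => (f (h x))%:R)%R).
  by move=> x y /eqP; rewrite eqr_nat => /eqP/fI/hI.
by move=> x y z w xy zw; rewrite !ltr_nat; apply: nc; rewrite hP.
Qed.

(** It suffices that every edge joins consecutive numbers or contains the vertex
    numbered 0. *)
Lemma fan_noncrossing (G : sgraph) (f : G -> nat) : injective f ->
  (forall x y, adj x y -> f x < f y -> f x = 0 \/ f y = (f x).+1) -> noncrossing f.
Proof.
move=> fI fP; split => // x y z w xy zw l1 l2 l3.
by have [] := fP x y xy (ltn_trans l1 l2); have [] := fP z w zw (ltn_trans l2 l3); lia.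
Qed.

(** Connectedness of graphs of diameter at most two, transported along an
    isomorphism. *)
Lemma isomorphic_connected (G H : sgraph) : isomorphic G H -> 0 < #|H| ->
  (forall x y : H, x != y -> adj x y \/ exists z, adj x z /\ adj y z) -> connected_graph G.
Proof.
case=> h [[g hK gK] hP] /card_gt0P[x0 _] near; split.
  by apply/card_gt0P; exists (g x0).
move=> x y; have [->|xy] := eqVneq x y; first exact: connect0.
have /near : h x != h y by rewrite (can_eq hK).
case=> [|[z []]]; first by rewrite hP; exact: connect1.
rewrite -{1 2}(gK z) !hP.
by rewrite [adj y _]adj_sym => /connect1 xz /connect1; exact: connect_trans.
Qed.

Lemma isomorphic_common_nbrs (G H : sgraph) : isomorphic G H -> exists2 h : G -> H, bijective h &
  forall u v, #|common_nbrs (h u) (h v)| = #|common_nbrs u v|.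
Proof.
case=> h [[g hK gK] hP]; exists h; first by exists g.
move=> u v; rewrite -(card_imset (common_nbrs u v) (can_inj hK)); apply: eq_card => z.
rewrite mem_common_nbrs; apply/andP/imsetP => [[uz vz]|[x + ->]]; last by rewrite mem_common_nbrs !hP => /andP.
by exists (g z); rewrite ?mem_common_nbrs ?gK // -!hP gK uz vz.
Qed.

Lemma isomorphic_A2 (G H : sgraph) a : isomorphic G H -> A2 G a <-> A2 H a.
Proof.
case/isomorphic_common_nbrs => h [g hK gK] hP; split=> -[u [v [uv <-]]].
  by exists (h u), (h v); rewrite hP; split => // /(can_inj hK).
by exists (g u), (g v); rewrite -hP !gK; split => // /(can_inj gK).
Qed.

Lemma isomorphic_common_nbrs_pos (G H : sgraph) : isomorphic G H ->
  (forall u v : H, u != v -> 0 < #|common_nbrs u v|) ->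
  forall u v : G, u != v -> 0 < #|common_nbrs u v|.
Proof.
case/isomorphic_common_nbrs => h hb hP pos u v uv; rewrite -hP; apply: pos.
by rewrite (inj_eq (bij_inj hb)).
Qed.

Section Concrete.
Variables (R : realType) (G : sgraph).

Lemma card_common_nbrs_sum (H : sgraph) (u v : H) :
  #|common_nbrs u v| = \sum_(x : H) (adj u x && adj v x).
Proof. by rewrite -sum1dep_card big_mkcond; apply: eq_bigr => x _; case: ifP. Qed.

Lemma K1_facts : isomorphic G (complete_graph 1) ->
  [/\ connected_graph G, outerplanar R G & forall a, ~ A2 G a].
Proof.
move=> iso; split.
- apply: (isomorphic_connected iso); first by rewrite [X in _ < X](card_ord 1).
  by move=> x y; rewrite (ord1 x) (ord1 y) eqxx.
- apply: (noncrossing_outerplanar (f := fun i : complete_graph 1 => @nat_of_ord 1 i) R iso).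
  by apply: fan_noncrossing => [|x y]; [exact: ord_inj|rewrite (ord1 x); left].
- by move=> a /(isomorphic_A2 a iso)[u [v []]]; rewrite (ord1 u) (ord1 v).
Qed.

Lemma K2_facts : isomorphic G (complete_graph 2) ->
  [/\ connected_graph G, outerplanar R G & forall a, A2 G a <-> a = 0].
Proof.
move=> iso; split.
- apply: (isomorphic_connected iso); first by rewrite [X in _ < X](card_ord 2).
  by move=> x y xy; left.
- apply: (noncrossing_outerplanar (f := fun i : complete_graph 2 => @nat_of_ord 2 i) R iso).
  apply: fan_noncrossing => [|x y _ xy]; first exact: ord_inj.
  by left; have := ltn_ord y; lia.
have cn0 (u v : complete_graph 2) : u != v -> #|common_nbrs u v| = 0.
  rewrite card_common_nbrs_sum !big_ord_recl big_ord0; case: u v => [[|[|?]] ?] [[|[|?]] ?] //.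
move=> a; rewrite (isomorphic_A2 a iso); split=> [[u [v [/eqP uv <-]]]|->].
  exact: cn0.
by exists ord0, ord_max; split => //; exact: cn0.
Qed.

Lemma square_facts : isomorphic G square_graph ->
  [/\ connected_graph G, outerplanar R G & forall a, A2 G a <-> a = 0 \/ a = 2].
Proof.
move=> iso; split.
- apply: (isomorphic_connected iso); first by rewrite [X in _ < X](card_ord 4).
  case=> [[|[|[|[|?]]]] ?] [[|[|[|[|?]]]] ?] // _; try (by left); right;
  by [exists (@Ordinal 4 0 isT)|exists (@Ordinal 4 1 isT)].
- apply: (noncrossing_outerplanar (f := fun i : square_graph => @nat_of_ord 4 i) R iso).
  apply: fan_noncrossing => [|[[|[|[|[|?]]]] ?] [[|[|[|[|?]]]] ?]] //=; try (by left); try (by right).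
  exact: ord_inj.
have cnE (u v : square_graph) : u != v -> #|common_nbrs u v| = if odd (u + v) then 0 else 2.
  by rewrite card_common_nbrs_sum !big_ord_recl big_ord0; case: u v => [[|[|[|[|?]]]] ?] [[|[|[|[|?]]]] ?].
move=> a; rewrite (isomorphic_A2 a iso); split=> [[u [v [/eqP/cnE-> <-]]]|[->|->]].
- by case: ifP; [left|right].
- by exists (@Ordinal 4 0 isT), (@Ordinal 4 1 isT); split => //; exact: cnE.
- by exists (@Ordinal 4 0 isT), (@Ordinal 4 2 isT); split => //; exact: cnE.
Qed.

Lemma friendship_facts : is_friendship G ->
  [/\ connected_graph G, outerplanar R G & forall a, A2 G a <-> a = 1].
Proof.
case=> l [l0 iso].
pose o : friendship_graph l := None.
have univ (x : friendship_graph l) : x != o -> adj o x by case: x.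
split.
- apply: (isomorphic_connected iso); first by apply/card_gt0P; exists o.
  move=> x y; have [->|xN] := eqVneq x o; first by rewrite eq_sym; left; exact: univ.
  have [->|yN] := eqVneq y o; first by left; rewrite adj_sym; exact: univ.
  by right; exists o; rewrite ![adj _ o]adj_sym !univ.
- pose f (x : friendship_graph l) := if x is Some (i, b) then (i.*2 + b).+1 else 0.
  apply: (noncrossing_outerplanar (f := f) R iso); apply: fan_noncrossing.
    move=> [[i b]|] [[j c]|] //= [E].
    have bc : b = c by case: b c E => [] [] //=; lia.
    by subst c; congr (Some (_, _)); apply: ord_inj; lia.
  move=> [[i b]|] [[j c]|] //=; try (by left).
  by case/andP=> /eqP ->; case: b c => [] [] //= _; right; lia.
have cn1 (u v : friendship_graph l) : u != v -> #|common_nbrs u v| = 1.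
  wlog uN : u v / u != o.
    move=> W uv; have [E|uN] := eqVneq u o; last exact: W.
    by rewrite common_nbrsC; apply: W; [rewrite -E eq_sym|rewrite eq_sym].
  case: u uN => [[i b]|] // _; case: v => [[j c]|] uv; apply/eqP/cards1P.
    exists o; apply/setP => -[[k d]|]; rewrite mem_common_nbrs inE //=.
    apply/negP => /andP[/andP[/eqP ik bd] /andP[/eqP jk cd]]; subst.
    by move: uv bd cd; case: b c d => [] [] [] //; rewrite eqxx.
  exists (Some (i, ~~ b)); apply/setP => -[[k d]|]; rewrite mem_common_nbrs inE //=.
  rewrite andbT; apply/andP/eqP => [[/eqP -> ]|[-> ->]]; first by case: b d {uv} => [] [].
  by rewrite eqxx; case: (b).
move=> a; rewrite (isomorphic_A2 a iso); split=> [[u [v [/eqP uv <-]]]|->].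
  exact: cn1.
by exists o, (Some (Ordinal l0, true)); split => //; exact: cn1.
Qed.

Lemma sun_facts : isomorphic G sun_graph ->
  [/\ connected_graph G, outerplanar R G, forall u v : G, u != v -> 0 < #|common_nbrs u v|
    & exists u v : G, u != v /\ 1 < #|common_nbrs u v|].
Proof.
move=> iso; pose pt n : sun_graph := inl (inord n).
have adjE (x : sun_graph) (k : 'I_3) : adj x (inl k) = (match x with inl i => i | inr i => i end != k).
  by case: x.
(* An inner vertex with an index other than those of [u] and [v] is adjacent to
   both. *)
have posS (u v : sun_graph) : u != v -> 0 < #|common_nbrs u v|.
  move=> _; have [k ku kv] : exists2 k : 'I_3, match u with inl i => i | inr i => i end != k &
      match v with inl i => i | inr i => i end != k.
    move: (match u with inl i => i | inr i => i end) (match v with inl i => i | inr i => i end) => i j.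
    case: i j => [[|[|[|?]]] ?] [[|[|[|?]]] ?] //;
    by [exists (@Ordinal 3 0 isT)|exists (@Ordinal 3 1 isT)|exists (@Ordinal 3 2 isT)].
  by apply/card_gt0P; exists (inl k); rewrite mem_common_nbrs !adjE ku.
split.
- apply: (isomorphic_connected iso); first by apply/card_gt0P; exists (inl ord0).
  by move=> x y /posS/card_gt0P[z]; rewrite mem_common_nbrs => /andP[? ?]; right; exists z.
(* The numbering follows the hexagon that bounds the 3-sun; [E] lists the edges. *)
- pose f (x : sun_graph) := match x with inl i => i.*2 | inr j => (j.*2 + 3) %% 6 end.
  pose E := [:: (0, 1); (1, 2); (2, 3); (3, 4); (4, 5); (0, 5); (0, 2); (2, 4); (0, 4)].
  have fE x y : adj x y -> f x < f y -> (f x, f y) \in E.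
    by case: x y => [[[|[|[|?]]] ?]|[[|[|[|?]]] ?]] [[[|[|[|?]]] ?]|[[|[|[|?]]] ?]].
  apply: (noncrossing_outerplanar (f := f) R iso); split.
    case=> [[[|[|[|?]]] ?]|[[|[|[|?]]] ?]] [[[|[|[|?]]] ?]|[[|[|[|?]]] ?]] //= _;
    by [congr inl; exact: ord_inj|congr inr; exact: ord_inj].
  move=> x y z w xy zw l1 l2 l3.
  have := fE x y xy (ltn_trans l1 l2); have := fE z w zw (ltn_trans l2 l3).
  have /allP nc : all (fun e => all (fun e' => ~~ [&& e'.1 < e.1, e.1 < e'.2 & e'.2 < e.2]) E) E by [].
  by move=> /nc /allP H /H /=; rewrite l1 l2 l3.
- exact: isomorphic_common_nbrs_pos iso posS.
have [h [g hK gK] hP] := isomorphic_common_nbrs iso.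
exists (g (inl (@Ordinal 3 0 isT))), (g (inl (@Ordinal 3 1 isT))).
rewrite (can_eq gK) -hP !gK; split => //.
apply/card_gt1P; exists (inl (@Ordinal 3 2 isT)), (inr (@Ordinal 3 2 isT)).
by rewrite !mem_common_nbrs.
Qed.

(** The numbering puts the apex first and then follows the path that contains
    [H]. *)
Lemma family_R_facts : family_R G ->
  [/\ connected_graph G, outerplanar R G, forall u v : G, u != v -> 0 < #|common_nbrs u v|
    & exists u v : G, u != v].
Proof.
case=> l [_ [H [H0 [f [fI fP]] niso iso]]].
pose J := join_graph H (complete_graph 1).
have posJ (u v : J) : u != v -> 0 < #|common_nbrs u v|.
  wlog : u v / if u is inl _ then true else false.
    move=> W uv; case: u uv => [x|i] uv; first exact: W.
    case: v uv => [y|j]; first by rewrite common_nbrsC eq_sym; apply: W.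
    by rewrite (ord1 i) (ord1 j) eqxx.
  case: u => // x _; case: v => [y|j] uv; apply/card_gt0P.
    by exists (inr ord0); rewrite mem_common_nbrs.
  by have [z xz] := niso x; exists (inl z); rewrite mem_common_nbrs /= xz.
split.
- apply: (isomorphic_connected iso).
    by apply/card_gt0P; exists (inr ord0).
  by move=> x y /posJ/card_gt0P[z]; rewrite mem_common_nbrs => /andP[? ?]; right; exists z.
- pose g (x : J) := if x is inl h then (f h : nat).+1 else 0.
  apply: (noncrossing_outerplanar (f := g) R iso); apply: fan_noncrossing.
    move=> [x|i] [y|j] //=; last by rewrite (ord1 i) (ord1 j).
    by case=> /ord_inj/fI->.
  move=> [x|i] [y|j] //=; try (by left).
  by move=> /fP /orP[]/eqP <- lt; [right|lia].
- exact: isomorphic_common_nbrs_pos iso posJ.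
- case: iso => h [[g hK gK] _]; have /card_gt0P[x _] := H0.
  by exists (g (inl x)), (g (inr ord0)); rewrite (can_eq gK).
Qed.
End Concrete.

(** * The classification *)
Section Classification.
Variables (R : realType) (G : sgraph).
Hypotheses (con : connected_graph G) (outer : outerplanar R G).
Implicit Types u v w x y z : G.

Lemma A2_card u v : u != v -> A2 G #|common_nbrs u v|.
Proof. by move=> /eqP uv; exists u, v. Qed.

Lemma A2_le2 a : A2 G a -> a <= 2.
Proof. by move=> [u [v [/eqP uv <-]]]; exact: (card_common_nbrs_le2 outer). Qed.

Lemma A2_pos : ~ A2 G 0 -> forall u v, u != v -> 0 < #|common_nbrs u v|.
Proof.
by move=> n0 u v /A2_card; rewrite lt0n; apply: contraPN => /eqP ->.
Qed.

Lemma classify_K1 : (forall a, ~ A2 G a) -> isomorphic G (complete_graph 1).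
Proof.
move=> none; apply: isomorphic_sym; have [/card_gt0P[x0 _] _] := con.
have all0 x : x = x0.
  by apply: contrapT => /eqP /A2_card; exact: none.
exists (fun _ => x0); split.
  by apply: inj_surj_bij => [i j _|x]; [rewrite (ord1 i) (ord1 j)|exists ord0].
by move=> i j; rewrite (ord1 i) (ord1 j) !adj_irr.
Qed.

Lemma classify_K2 : A2 G 0 -> ~ A2 G 1 -> ~ A2 G 2 -> isomorphic G (complete_graph 2).
Proof.
move=> [u [v [/eqP uv _]]] n1 n2; apply: isomorphic_sym.
have nocn x y z : x != y -> adj x z -> adj y z -> False.
  move=> xy xz yz; have /card_gt0P pos : exists z, z \in common_nbrs x y.
    by exists z; rewrite mem_common_nbrs xz.
  have := A2_card xy; have := card_common_nbrs_le2 outer xy.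
  by case: #|_| pos => [|[|[|]]].
have [a ua] : exists a, adj u a.
  apply: contrapT => H; have : v == u.
    apply: (connected_invariant (A := fun x => x == u) (x0 := u) con) => // x y /eqP -> uy.
    by case: H; exists y.
  by rewrite eq_sym (negPf uv).
have all2 x : (x == u) || (x == a).
  apply: (connected_invariant (x0 := u) (A := fun x => (x == u) || (x == a)) con); first by rewrite eqxx.
  move=> y z /orP[]/eqP-> yz; apply/norP => -[zu za].
    by apply: (nocn z a u) => //; rewrite adj_sym.
  by apply: (nocn z u a) => //; rewrite adj_sym.
have au := adj_neq_sym ua.
exists (fun i : complete_graph 2 => if i == ord0 then u else a); split.
  apply: inj_surj_bij.
    case=> [[|[|?]] ?] [[|[|?]] ?] //= E; try exact: ord_inj.
      by rewrite E eqxx in au.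
    by rewrite -E eqxx in au.
  move=> x; case/orP: (all2 x) => /eqP->; first by exists ord0.
  by exists ord_max.
by case=> [[|[|?]] ?] [[|[|?]] ?] //=; rewrite ?adj_irr // adj_sym.
Qed.

Lemma classify_friendship : A2 G 1 -> ~ A2 G 0 -> ~ A2 G 2 -> is_friendship G.
Proof.
move=> [u [v [/eqP uv _]]] n0 n2.
have one x y : x != y -> #|common_nbrs x y| = 1.
  move=> xy; have := A2_card xy; have := card_common_nbrs_le2 outer xy.
  by case: #|_| => [|[|[|]]].
have [c cP] := friendship_universal outer one u.
apply: (universal_friendship cP) => //.
have [E|uc] := eqVneq u c; last by exists u.
by exists v; rewrite -E eq_sym.
Qed.

Lemma classify_square : A2 G 2 -> ~ A2 G 1 -> isomorphic G square_graph.
Proof.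
move=> [u [v [/eqP uv E]]] n1; apply: isomorphic_sym.
apply: (zero_two_square outer _ con uv E) => x y xy.
have := A2_card xy; have := card_common_nbrs_le2 outer xy.
by case: #|_| => [|[|[|]]] //; [left|right].
Qed.

Lemma classify_R_sun : A2 G 2 -> ~ A2 G 0 -> family_R G \/ isomorphic G sun_graph.
Proof.
move=> [u [v [/eqP uv E]]] /A2_pos pos.
have [[c cP]|nu] := pselect (exists c, forall x, x != c -> adj c x).
  left; apply: (universal_family_R outer cP) => //.
  have [E'|uc] := eqVneq u c; last by exists u.
  by exists v; rewrite -E' eq_sym.
right; apply: isomorphic_sym; apply: (no_universal_sun outer pos _ uv); last by rewrite E.
move=> c; apply: contrapT => H; apply: nu; exists c => x xc.
by apply: contrapT => /negP cx; apply: H; exists x.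
Qed.

Lemma square_subgraph : subgraph square_graph G <-> A2 G 2.
Proof.
split=> [[f [fI fP]]|[u [v [/eqP uv /eqP/cards2P[x [y [xy E]]]]]]].
  pose o n (lt : n < 4) : square_graph := Ordinal lt.
  have uv : f (o 0 isT) != f (o 2 isT) by rewrite (inj_eq fI).
  suff <- : #|common_nbrs (f (o 0 isT)) (f (o 2 isT))| = 2 by exact: A2_card.
  apply/eqP; rewrite eqn_leq (card_common_nbrs_le2 outer uv); apply/card_gt1P.
  exists (f (o 1 isT)), (f (o 3 isT)); rewrite !mem_common_nbrs !fP //.
  by split => //; rewrite (inj_eq fI).
have [[ux vx] [uy vy]] : (adj u x /\ adj v x) /\ (adj u y /\ adj v y).
  by split; apply/andP; rewrite -mem_common_nbrs E !inE eqxx ?orbT.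
exists (fun i : 'I_4 => nth u [:: u; x; v; y] i); split.
  move=> i j /eqP; rewrite nth_uniq // => [/eqP/ord_inj //|].
  by rewrite /= !inE !negb_or uv xy (adj_neq ux) (adj_neq uy) (adj_neq_sym vx) (adj_neq vy).
have [xu xv yu yv] : [/\ adj x u, adj x v, adj y u & adj y v] by rewrite ![adj x _]adj_sym ![adj y _]adj_sym.
by case=> [[|[|[|[|?]]]] ?] [[|[|[|[|?]]]] ?].
Qed.
End Classification.

(** Any two vertices have a common neighbour.  Some pair has two because the graph
    is not a friendship graph, and some pair has just one because otherwise the
    graph would be a square, in which adjacent vertices have none. *)
Lemma family_R_A2 (R : realType) (G : sgraph) : family_R G -> ~ is_friendship G ->
  [/\ connected_graph G, outerplanar R G & forall a, A2 G a <-> a = 1 \/ a = 2].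
Proof.
move=> fam nD; have [con outer pos [u [v uv]]] := family_R_facts R fam.
have n0 : ~ A2 G 0 by move=> [x [y [/eqP/pos + E]]]; rewrite E.
have p2 : A2 G 2.
  apply: contrapT => n2; apply: nD; apply: (classify_friendship outer) => //.
  have := A2_card uv; have := card_common_nbrs_le2 outer uv.
  by case: #|_| => [|[|[|]]].
have p1 : A2 G 1.
  apply: contrapT => n1; apply: n0.
  by have [_ _ ->] := square_facts R (classify_square con outer p2 n1); left.
split=> // a; split=> [Aa|[]-> //].
have := A2_le2 outer Aa; case: a Aa => [|[|[|]]] // _ _; [by left|by right].
Qed.

Lemma sun_A2 (R : realType) (G : sgraph) : isomorphic G sun_graph ->
  [/\ connected_graph G, outerplanar R G & forall a, A2 G a <-> a = 1 \/ a = 2].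
Proof.
move=> iso; have [con outer pos [u [v [uv lt]]]] := sun_facts R iso.
have n0 : ~ A2 G 0 by move=> [x [y [/eqP/pos + E]]]; rewrite E.
have p2 : A2 G 2.
  suff <- : #|common_nbrs u v| = 2 by exact: A2_card.
  by apply/eqP; rewrite eqn_leq (card_common_nbrs_le2 outer uv).
have p1 : A2 G 1.
  apply: contrapT => n1; apply: n0.
  by have [_ _ ->] := square_facts R (classify_square con outer p2 n1); left.
split=> // a; split=> [Aa|[]-> //].
have := A2_le2 outer Aa; case: a Aa => [|[|[|]]] // _ _; [by left|by right].
Qed.

Local Open Scope classical_set_scope.

Lemma A2_set1 (G : sgraph) a : A2 G = [set a] <-> forall b, A2 G b <-> b = a.
Proof. by split=> [->|H]; last (apply/predeqP => b; exact: H). Qed.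

Lemma A2_set2 (G : sgraph) a b : A2 G = [set a; b] <-> forall c, A2 G c <-> c = a \/ c = b.
Proof. by split=> [->|H]; last (apply/predeqP => c; exact: H). Qed.

Theorem corollaryB2 (R : realType) (G : sgraph) :
  let C := connected_graph G /\ outerplanar R G in
  let is_K1 := isomorphic G (complete_graph 1) in
  let is_K2 := isomorphic G (complete_graph 2) in
  let is_D := is_friendship G in
  let no_C4_other := ~ subgraph square_graph G /\ ~ is_D /\ ~ is_K1 /\ ~ is_K2 in
  let is_square := isomorphic G square_graph in
  let in_R_or_sun := (family_R G /\ ~ is_D) \/ isomorphic G sun_graph in
  (C /\ A2 G = set0 <-> is_K1) /\
  (C /\ A2 G = [set 0%N] <-> is_K2) /\
  (C /\ A2 G = [set 1%N] <-> is_D) /\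
  (C /\ A2 G = [set 0%N; 1%N] <-> C /\ no_C4_other) /\
  (C /\ A2 G = [set 0%N; 2%N] <-> is_square) /\
  (C /\ A2 G = [set 1%N; 2%N] <-> in_R_or_sun) /\
  (C /\ A2 G = [set 0%N; 1%N; 2%N] <->
     C /\ ~ is_K1 /\ ~ is_K2 /\ ~ is_D /\ ~ no_C4_other /\ ~ is_square /\
     ~ in_R_or_sun).
Proof.
move=> C is_K1 is_K2 is_D no_C4_other is_square in_R_or_sun.
have le2 a : C -> A2 G a -> [\/ a = 0, a = 1 | a = 2].
  move=> [_ outer] /(A2_le2 outer).
  by case: a => [|[|[|]]] // _; [apply: Or31|apply: Or32|apply: Or33].
have rowK1 : C /\ A2 G = set0 <-> is_K1.
  split=> [[[con outer] E]|iso]; first by apply: (classify_K1 con) => a; rewrite E.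
  have [con outer none] := K1_facts R iso; split => //.
  by apply/predeqP => a; split=> // /none.
have rowK2 : C /\ A2 G = [set 0%N] <-> is_K2.
  rewrite A2_set1; split=> [[[con outer] E]|iso]; last by have [] := K2_facts R iso.
  by apply: (classify_K2 con outer); rewrite E.
have rowD : C /\ A2 G = [set 1%N] <-> is_D.
  rewrite A2_set1; split=> [[[con outer] E]|iso]; last by have [] := friendship_facts R iso.
  by apply: (classify_friendship outer); rewrite E.
have rowC4 : C /\ A2 G = [set 0%N; 1%N] <-> C /\ no_C4_other.
  rewrite A2_set2; split=> [[[con outer] E]|[c [nC4 [nD [n1 n2]]]]].
    split=> //; split; [|split; [|split]].
    - by rewrite (square_subgraph outer) E => -[].
    - by move=> /(friendship_facts R)[_ _ D]; have := (E 0).2 (or_introl erefl); rewrite D.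
    - by move=> /(K1_facts R)[_ _ D]; have := (E 0).2 (or_introl erefl); exact: D.
    - by move=> /(K2_facts R)[_ _ D]; have := (E 1).2 (or_intror erefl); rewrite D.
  have [con outer] := c; rewrite (square_subgraph outer) in nC4.
  have p0 : A2 G 0.
    apply: contrapT => n0; have [p1|np1] := pselect (A2 G 1).
      by apply: nD; exact: (classify_friendship outer).
    by apply: n1; apply: (classify_K1 con) => a Aa; case: (le2 a c Aa) => E; subst.
  have p1 : A2 G 1 by apply: contrapT => np1; apply: n2; exact: (classify_K2 con outer).
  split=> // a; split=> [Aa|[]-> //].
  by case: (le2 a c Aa) => E; subst; [left|right|].
have rowS : C /\ A2 G = [set 0%N; 2%N] <-> is_square.
  rewrite A2_set2; split=> [[[con outer] E]|iso]; last by have [] := square_facts R iso.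
  by apply: (classify_square con outer); rewrite E; [right|case].
have rowR : C /\ A2 G = [set 1%N; 2%N] <-> in_R_or_sun.
  rewrite A2_set2; split=> [[[con outer] E]|[[fam nD]|iso]].
  - have [||fam|iso] := classify_R_sun outer; [by rewrite E; right|by rewrite E; case|left|by right].
    split => // /(friendship_facts R)[_ _ D].
    by have := (E 2).2 (or_intror erefl); rewrite D.
  - by have [] := family_R_A2 R fam nD.
  - by have [] := sun_A2 R iso.
do 6 (split => //).
split=> [[c E]|[c [nK1 [nK2 [nD [nC4 [nS nR]]]]]]].
  have P a : A2 G a <-> [\/ a = 0, a = 1 | a = 2].
    by rewrite E; split=> [[[]|]|[]] ->; [apply: Or31|apply: Or32|apply: Or33|left; left|left; right|right].
  have [p0 p1 p2] : [/\ A2 G 0, A2 G 1 & A2 G 2].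
    by split; apply/P; [apply: Or31|apply: Or32|apply: Or33].
  split=> //; rewrite -rowK1 -rowK2 -rowD -rowS -rowR.
  have -> : no_C4_other <-> C /\ no_C4_other by tauto.
  rewrite -rowC4 !A2_set1 !A2_set2.
  split; first by case=> _ E0; rewrite E0 in p0.
  by do !split; case=> _ H; move: p0 p1 p2; rewrite !H; lia.
have p2 : A2 G 2.
  have [_ outer] := c; rewrite -(square_subgraph outer).
  by apply: contrapT => n; apply: nC4.
have p1 : A2 G 1.
  by have [con outer] := c; apply: contrapT => n1; apply: nS; exact: (classify_square con outer).
have p0 : A2 G 0.
  apply: contrapT => n0; apply: nR; apply/rowR; split => //; rewrite A2_set2 => a.
  split=> [Aa|[]-> //].
  by case: (le2 a c Aa) => E; subst; [|left|right].
split=> //; apply/predeqP => a; split=> [/(le2 a c)[]->|[[]|]-> //]; [left; left|left; right|right] => //.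
Qed.
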